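(* Let $V$ be a vertex operator algebra over $\mathbb{C}$ and let $W_i=\bigoplus_{j=0}^\infty (W_i)_{\lambda_i+j}$, $i=1,2,3$, be three weak $V$-modules, where $\lambda_i\in\mathbb{C}$, $(W_i)_h=\{u\in W_i\mid (L(0)-h)^nu=0\text{ for some }n\in\mathbb{Z}_{>0}\}$ and $\dim_{\mathbb{C}}(W_i)_h<\infty$ for $h\in\lambda_i+\mathbb{Z}$. Regard $W_i$ as an $\mathbb{N}$-graded weak $V$-module by $W_i(j)=(W_i)_{\lambda_i+j}$. For a logarithmic intertwining operator $I(\ ,x)=\sum_{n\ge 0}I^{(n)}(\ ,x)(\log x)^n$ of type $\binom{W_3}{W_1\ W_2}$, with $I^{(n)}(\ ,x):W_1\otimes_{\mathbb{C}}W_2\to W_3\{x\}$, put $I^{o}(\ ,x)=x^{\lambda_1+\lambda_2-\lambda_3}I^{(0)}(\ ,x)$. Then the map $$I_{\log}\binom{W_3}{W_1\ W_2}\rightarrow I_{\mathbb{Z}}\binom{W_3}{W_1\ W_2},\qquad I(\ ,x)\mapsto I^{o}(\ ,x),$$ from the space of logarithmic intertwining operators to the space of $\mathbb{Z}$-graded intertwining operators of type $\binom{W_3}{W_1\ W_2}$, is a linear isomorphism.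
   Context: $\mathbb{N}$ is the set of non-negative integers; $x,y,x_0,x_1,x_2$ are commuting formal variables, and $\log x$ is a formal variable with $\frac{d}{dx}\log x=x^{-1}$. $(V,Y,\mathbf{1},\omega)$ is a vertex operator algebra over $\mathbb{C}$, graded by weights; on a weak $V$-module $M$ write $Y_M(\omega,x)=\sum_{i\in\mathbb{Z}}L(i)x^{-i-2}$ and $Y_M(a,x)=\sum_i a_ix^{-i-1}$. For a vector space $M$, $M\{x\}=\{\sum_{\alpha\in\mathbb{C}}u_\alpha x^\alpha\mid u_\alpha\in M\}$ and $M((x))$ is the space of formal Laurent series with finitely many negative powers. Logarithmic intertwining operators. A logarithmic intertwining operator of type $\binom{W_3}{W_1\ W_2}$ is a linear map $I(\ ,x):W_1\otimes_{\mathbb{C}}W_2\to W_3[\log x]\{x\}$, $I(u,x)v=\sum_{\alpha\in\mathbb{C}}\sum_{n=0}^\infty u_{\alpha,n}v\,x^{-\alpha-1}(\log x)^n$ with $u_{\alpha,n}\in\operatorname{Hom}_{\mathbb{C}}(W_2,W_3)$, such that: (1) for $u\in W_1,v\in W_2,\alpha\in\mathbb{C}$, $u_{\alpha+m,k}v=0$ for $m\in\mathbb{N}$ sufficiently large, independently of $k$; (2) for $u\in W_1$, $a\in V$, $x_0^{-1}\delta(\frac{x_1-x_2}{x_0})Y(a,x_1)I(u,x_2)-x_0^{-1}\delta(\frac{x_2-x_1}{-x_0})I(u,x_2)Y(a,x_1)=x_1^{-1}\delta(\frac{x_2+x_0}{x_1})I(Y(a,x_0)u,x_2)$; (3) $I(L(-1)u,x)=\frac{d}{dx}I(u,x)$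 for $u\in W_1$. The space of these is $I_{\log}\binom{W_3}{W_1\ W_2}$. One has $u_{\alpha,n}v=0$ for $\alpha\notin\lambda_1+\lambda_2-\lambda_3+\mathbb{Z}$, so $I^{o}$ involves only integral powers of $x$. $\mathbb{N}$-graded weak modules. A weak $V$-module $M$ is $\mathbb{N}$-graded if $M=\bigoplus_{j=0}^{\infty}M(j)$ with $a_kM(j)\subset M(\mathrm{wt}\,a+j-k-1)$ for homogeneous $a\in V$, $j\in\mathbb{N}$, $k\in\mathbb{Z}$ (with $M(j)=0$ for $j<0$). $\mathbb{Z}$-graded intertwining operators. For a vector space $M$, define linear injective maps on $M[[x,y]][x^{-1},y^{-1},(x-y)^{-1}]$, namely $\iota_{x,y}$ into $M((x))((y))$, $\iota_{y,x}$ into $M((y))((x))$, $\iota_{x,y-x}$ into $M((x))((y-x))$, determined by $\iota_{x,y}(x^jy^k(x-y)^l)=\sum_{i\ge0}\binom{l}{i}(-1)^ix^{j+l-i}y^{k+i}$, $\iota_{y,x}(x^jy^k(x-y)^l)=\sum_{i\ge0}\binom{l}{i}(-1)^{l-i}y^{k+l-i}x^{j+i}$, $\iota_{x,y-x}(x^jy^k(x-y)^l)=\sum_{i\ge0}\binom{k}{i}x^{j+k-i}(-1)^l(y-x)^{l+i}$ for $j,k,l\in\mathbb{Z}$, and being the identity on $M$. For $\mathbb{N}$-graded weak $V$-modules $W_1,W_2,W_3$, a $\mathbb{Z}$-graded intertwining operator of type $\binom{W_3}{W_1\ W_2}$ is a linear map $\Phi(\ ,x)=\sum_{n\in\mathbb{Z}}\Phi(\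 ;n)x^{-n-1}:W_1\otimes_{\mathbb{C}}W_2\to W_3((x))$ such that: (1) $\Phi(u;k)W_2(j)\subset W_3(i+j-k-1)$ for $i,j\in\mathbb{N}$, $k\in\mathbb{Z}$, $u\in W_1(i)$; (2) for $u\in W_1$, $v\in W_2$, $a\in V$ there exists $\Phi(a,u,v|x,y)\in W_3[[x,y]][x^{-1},y^{-1},(x-y)^{-1}]$ such that $\iota_{x,y}\Phi(a,u,v|x,y)=\Phi(u,x)Y_{W_2}(a,y)v$, $\iota_{y,x}\Phi(a,u,v|x,y)=Y_{W_3}(a,y)\Phi(u,x)v$ and $\iota_{x,y-x}\Phi(a,u,v|x,y)=\Phi(Y_{W_1}(a,y-x)u,x)v$. The space of these is $I_{\mathbb{Z}}\binom{W_3}{W_1\ W_2}$. *)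

(* Defs.v *)
From HB Require Import structures.
From mathcomp Require Import all_boot all_order all_algebra.
From mathcomp Require Import boolp classical_sets functions cardinality fsbigop.
From mathcomp Require Import reals complex ring zify.

Set Implicit Arguments.
Unset Strict Implicit.
Unset Printing Implicit Defensive.

Import Order.TTheory GRing.Theory Num.Theory.

Local Open Scope classical_set_scope.
Local Open Scope ring_scope.

(* The complex field is R[i] for a real number structure R.  Formal series are
   functions giving their coefficients.  Following the mode convention
   Y(a,x)b = sum_n a_n b x^(-n-1), an "operator series" Y of type
   W1 -> W2 -> A -> W3 has Y u v n = the coefficient of x^(-n-1) in Y(u,x)v;
   the exponents range over A = int or A = R[i].

   The sums \sum_(i \in D) F i over an infinite D are sums of finitely supported
   families; wherever they are used below, finiteness of the support follows
   from the truncation conditions imposed on the series involved. *)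

Definition binz (R : realType) (l : int) (i : nat) : R[i] :=
  (\prod_(j < i) (l - (j : nat)%:Z)%:~R) / (i`!)%:R.
Arguments binz R l i : clear implicits.

Section LinearAlgebra.
Context {R : realType}.
Implicit Types M : lmodType R[i].

Definition subspace M (D : set M) : Prop :=
  D 0 /\ forall (c : R[i]) (u v : M), D u -> D v -> D (c *: u + v).

Definition finite_dim M (D : set M) : Prop :=
  exists (n : nat) (e : 'I_n -> M), (forall i, D (e i)) /\
    forall u, D u -> exists c : 'I_n -> R[i], u = \sum_(i < n) c i *: e i.

Definition direct_sum (I : choiceType) M (D : I -> set M) : Prop :=
  (forall i, subspace (D i)) /\
  forall w : M, exists! f : I -> M,
    [/\ finite_set [set i | f i <> 0], (forall i, D i (f i)) &
        w = \sum_(i \in [set: I]) f i].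

Definition bilin (A : Type) (W1 W2 W3 : lmodType R[i])
    (I : W1 -> W2 -> A -> W3) : Prop :=
  (forall v n, linear (fun u => I u v n)) /\
  (forall u n, linear (fun v => I u v n)).

(* Membership of sum_n (f n) x^(-n-1) in M((x)). *)
Definition in_laurent M (f : int -> M) : Prop :=
  exists N : int, forall n, N <= n -> f n = 0.

(* The identity
     x0^-1 delta((x1-x2)/x0) Y3(a,x1) I(u,x2) v
     - x0^-1 delta((x2-x1)/-x0) I(u,x2) Y2(a,x1) v
     = x1^-1 delta((x2+x0)/x1) I(Y1(a,x0)u,x2) v
   for all u and v, for a fixed a: the two sides are compared at
   x0^(-l-1) x1^(-m-1) x2^(-al-1), where delta(x) = sum_(n in Z) x^n and a
   binomial (x+y)^n is expanded in nonnegative powers of the second variable y. *)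
Definition jacobi (A : pzRingType) (W1 W2 W3 : lmodType R[i])
    (Y1a : W1 -> int -> W1) (Y2a : W2 -> int -> W2) (Y3a : W3 -> int -> W3)
    (I : W1 -> W2 -> A -> W3) : Prop :=
  forall (u : W1) (v : W2) (l m : int) (al : A),
    \sum_(i \in [set: nat])
       ((-1) ^+ i * binz R l i) *: Y3a (I u v (al + i%:R)) (m + l - i%:Z)
    - \sum_(i \in [set: nat])
       ((-1) ^ l * (-1) ^+ i * binz R l i) *:
         I u (Y2a v (m + i%:Z)) (al + l%:~R - i%:R)
    = \sum_(i \in [set: nat])
       binz R m i *: I (Y1a u (l + i%:Z)) v (al + m%:~R - i%:R).

End LinearAlgebra.

Section VertexOperatorAlgebras.
Context {R : realType}.

(* The memberships vac in V_(0) and omega in V_(2) follow from the axioms. *)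
Record voa := Voa {
  voa_sort :> lmodType R[i];
  voa_Y : voa_sort -> voa_sort -> int -> voa_sort;
  vac : voa_sort;
  omega : voa_sort;
  central_charge : R[i];
  wt_space : int -> set voa_sort;
  voa_L := fun (n : int) (b : voa_sort) => voa_Y omega b (n + 1);
  voa_direct_sum : direct_sum wt_space;
  voa_finite_dim : forall n, finite_dim (wt_space n);
  voa_bounded_below : exists N : int, forall n, n < N -> wt_space n = [set 0];
  voa_bilin : bilin voa_Y;
  voa_trunc : forall a b, in_laurent (voa_Y a b);
  voa_vac : forall b n, voa_Y vac b n = if n == -1 then b else 0;
  voa_creation : forall a n, 0 <= n -> voa_Y a vac n = 0;
  voa_creation_lim : forall a, voa_Y a vac (-1) = a;
  voa_jacobi : forall a, jacobi (voa_Y a) (voa_Y a) (voa_Y a) voa_Y;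
  voa_virasoro : forall (m n : int) b,
    voa_L m (voa_L n b) - voa_L n (voa_L m b) =
    (m - n)%:~R *: voa_L (m + n) b +
    (if m + n == 0 then (m ^+ 3 - m)%:~R / 12%:R * central_charge else 0) *: b;
  voa_wt : forall n a, wt_space n a -> voa_L 0 a = n%:~R *: a;
  voa_deriv : forall a b n,
    voa_Y (voa_L (-1) a) b n = (- n)%:~R *: voa_Y a b (n - 1) }.

Record wmodule (V : voa) := WModule {
  wmod_sort :> lmodType R[i];
  wmod_Y : V -> wmod_sort -> int -> wmod_sort;
  wmod_bilin : bilin wmod_Y;
  wmod_trunc : forall a w, in_laurent (wmod_Y a w);
  wmod_vac : forall w n, wmod_Y (vac V) w n = if n == -1 then w else 0;
  wmod_jacobi : forall a, jacobi (voa_Y a) (wmod_Y a) (wmod_Y a) wmod_Y }.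

Definition wmod_L (V : voa) (M : wmodule V) (n : int) (w : M) : M :=
  wmod_Y (omega V) w (n + 1).

(* M(j) for j in Z, with M(j) = 0 for j < 0. *)
Definition extend0 (M : lmodType R[i]) (D : nat -> set M) (j : int) : set M :=
  if j is Posz n then D n else [set 0].

Record ngmodule (V : voa) := NGModule {
  ng_mod :> wmodule V;
  ng_space : nat -> set ng_mod;
  ng_direct_sum : direct_sum ng_space;
  ng_act : forall (p : int) (a : V) (j : nat) (k : int) (w : ng_mod),
    wt_space p a -> ng_space j w ->
    extend0 ng_space (p + j%:Z - k - 1) (wmod_Y a w k) }.

(* The space (M)_h. *)
Definition gen_eigenspace (V : voa) (M : wmodule V) (h : R[i]) : set M :=
  [set u | exists n : nat, (0 < n)%N /\
           iter n (fun w => wmod_L 0 w - h *: w) u = 0].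
Arguments gen_eigenspace {V} M h.

Definition L0_decomposed (V : voa) (M : wmodule V) (lam : R[i]) : Prop :=
  direct_sum (fun j : nat => gen_eigenspace M (lam + j%:R)).

End VertexOperatorAlgebras.
Arguments voa R : clear implicits.
Arguments ng_space {R V} n j.
Arguments gen_eigenspace {R V} M h.

Section LogarithmicIntertwiningOperators.
Context {R : realType} {V : voa R}.

(* f al k is the coefficient of x^(-al-1) (log x)^k. *)
Definition log_derivative (M : lmodType R[i]) (f : R[i] -> nat -> M) :
    R[i] -> nat -> M :=
  fun al k => (- al) *: f (al - 1) k + k.+1%:R *: f (al - 1) k.+1.

(* I u v al k = u_{al,k} v; the second clause says that I(u,x)v lies in
   W3[log x]{x}. *)
Definition is_log_intertwining (W1 W2 W3 : wmodule V)
    (I : W1 -> W2 -> R[i] -> nat -> W3) : Prop :=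
  [/\ forall k, bilin (fun u v al => I u v al k),
      forall u v al, exists K, forall k, (K <= k)%N -> I u v al k = 0,
      forall u v al, exists N, forall m k, (N <= m)%N -> I u v (al + m%:R) k = 0,
      forall a k, jacobi (wmod_Y a) (wmod_Y a) (wmod_Y a)
                         (fun u v al => I u v al k) &
      forall u v, I (wmod_L (-1) u) v = log_derivative (I u v)].

Definition log_intertwining_pred (W1 W2 W3 : wmodule V) :
    {pred W1 -> W2 -> R[i] -> nat -> W3} :=
  fun I => `[< is_log_intertwining I >].

Record I_log (W1 W2 W3 : wmodule V) := ILog {
  I_log_val :> W1 -> W2 -> R[i] -> nat -> W3;
  I_log_prop : I_log_val \in @log_intertwining_pred W1 W2 W3 }.

End LogarithmicIntertwiningOperators.

Section ZGradedIntertwiningOperators.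
Context {R : realType} {V : voa R}.

(* The element f(x,y) x^-p y^-q (x-y)^-r with f = sum_(j,k) (num j k) x^j y^k
   in M[[x,y]]. *)
Record fraction (M : lmodType R[i]) := Fraction {
  num : nat -> nat -> M;
  den_x : nat;
  den_y : nat;
  den_xy : nat }.

(* An element of M[[x,y]][x^-1,y^-1,(x-y)^-1], as a finite sum of fractions. *)
Definition localized (M : lmodType R[i]) := seq (fraction M).

(* Coefficients of the expansions of x^j y^k (x-y)^l: at x^s y^t for iota_xy and
   iota_yx, at x^s (y-x)^t for iota_xz. *)
Definition iota_xy (j k l s t : int) : R[i] :=
  \sum_(i \in [set i : nat | s = j + l - i%:Z /\ t = k + i%:Z])
     binz R l i * (-1) ^+ i.

Definition iota_yx (j k l s t : int) : R[i] :=
  \sum_(i \in [set i : nat | t = k + l - i%:Z /\ s = j + i%:Z])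
     binz R l i * (-1) ^ (l - i%:Z).

Definition iota_xz (j k l s t : int) : R[i] :=
  \sum_(i \in [set i : nat | s = j + k - i%:Z /\ t = l + i%:Z])
     binz R k i * (-1) ^ l.

Definition expand (iota : int -> int -> int -> int -> int -> R[i])
    (M : lmodType R[i]) (G : localized M) (s t : int) : M :=
  \sum_(F <- G) \sum_(jk \in [set: nat * nat])
     iota (jk.1%:Z - (den_x F)%:Z) (jk.2%:Z - (den_y F)%:Z) (- (den_xy F)%:Z) s t
       *: num F jk.1 jk.2.

Definition is_Z_intertwining (W1 W2 W3 : ngmodule V)
    (Phi : W1 -> W2 -> int -> W3) : Prop :=
  [/\ bilin Phi,
      forall u v, in_laurent (Phi u v),
      forall (i j : nat) (k : int) u v, ng_space W1 i u -> ng_space W2 j v ->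
        extend0 (ng_space W3) (i%:Z + j%:Z - k - 1) (Phi u v k) &
      forall (u : W1) (v : W2) (a : V), exists F : localized W3,
        forall m n : int,
        [/\ expand iota_xy F (- m - 1) (- n - 1) = Phi u (wmod_Y a v n) m,
            expand iota_yx F (- m - 1) (- n - 1) = wmod_Y a (Phi u v m) n &
            expand iota_xz F (- m - 1) (- n - 1) = Phi (wmod_Y a u n) v m]].

Definition Z_intertwining_pred (W1 W2 W3 : ngmodule V) :
    {pred W1 -> W2 -> int -> W3} :=
  fun Phi => `[< is_Z_intertwining Phi >].

Record I_Z (W1 W2 W3 : ngmodule V) := IZ {
  I_Z_val :> W1 -> W2 -> int -> W3;
  I_Z_prop : I_Z_val \in @Z_intertwining_pred W1 W2 W3 }.

End ZGradedIntertwiningOperators.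

Section FormalPowers.
Context {R : realType} (M : lmodType R[i]).

(* The series x^lam * f(x), for f in M{x}. *)
Definition mul_xpow (lam : R[i]) (f : R[i] -> M) : R[i] -> M :=
  fun al => f (al + lam).

(* The series sum_n (f n) x^(-n-1), over integers n, as an element of M{x}. *)
Definition integral_series (f : int -> M) : R[i] -> M :=
  fun al => \sum_(n \in [set n : int | n%:~R = al]) f n.

End FormalPowers.

Section FiniteSums.
Context {R : realType} {M : lmodType R[i]}.

Lemma fsum_widen (f : nat -> M) N : (forall i, (N <= i)%N -> f i = 0) ->
  \sum_(i \in [set: nat]) f i = \sum_(i < N) f i.
Proof.
move=> f0; rewrite (@fsbig_ord _ _ _ N f); symmetry; apply: fsbig_widen => //.
by move=> i [_ /= /negP]; rewrite -leqNgt => /f0.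
Qed.

Lemma fsum_single (f : nat -> M) k : (forall i, i <> k -> f i = 0) ->
  \sum_(i \in [set: nat]) f i = f k.
Proof.
move=> f0; rewrite (@fsum_widen _ k.+1) => [|i ki]; last first.
  by apply: f0 => ik; rewrite ik ltnn in ki.
by rewrite big_ord_recr /= big1 ?add0r// => i _; apply: f0 => ik;
  have := ltn_ord i; rewrite ik ltnn.
Qed.

Lemma fsum0 (I : choiceType) (f : I -> M) : (forall i, f i = 0) ->
  \sum_(i \in [set: I]) f i = 0.
Proof. by move=> f0; apply: fsbig1. Qed.

Lemma fsum_lin (I : choiceType) (c : R[i]) (f g : I -> M) :
  finite_set [set i | f i <> 0] -> finite_set [set i | g i <> 0] ->
  \sum_(i \in [set: I]) (c *: f i + g i) =
  c *: (\sum_(i \in [set: I]) f i) + \sum_(i \in [set: I]) g i.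
Proof.
move=> ff fg; set D := [set i | f i <> 0] `|` [set i | g i <> 0].
have fD : finite_set D by rewrite finite_setU.
have wid (h : I -> M) : (forall i, ~ D i -> h i = 0) ->
    \sum_(i \in [set: I]) h i = \sum_(i \in D) h i.
  by move=> h0; symmetry; apply: fsbig_widen => // i [_ /= /h0].
have f0 i : ~ D i -> f i = 0 by move=> nD; apply/notP => fi; apply: nD; left.
have g0 i : ~ D i -> g i = 0 by move=> nD; apply/notP => gi; apply: nD; right.
rewrite !wid//; last by move=> i nD; rewrite f0// g0// scaler0 addr0.
by rewrite !fsbig_finite//= scaler_sumr big_split.
Qed.

Lemma bounded_finite_supp (f : nat -> M) N : (forall i, (N <= i)%N -> f i = 0) ->
  finite_set [set i | f i <> 0].
Proof.
move=> f0; apply: (sub_finite_set _ (finite_II N)) => i /= fi.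
by rewrite ltnNge; apply/negP => /f0.
Qed.

End FiniteSums.

Section LogClosed.
Context {R : realType} {V : voa R} (W1 W2 W3 : wmodule V).

Lemma bilinD (A : Type) (U1 U2 U3 : lmodType R[i]) (I : U1 -> U2 -> A -> U3) :
  bilin I -> (forall c u u' v n, I (c *: u + u') v n = c *: I u v n + I u' v n)
  /\ (forall c u v v' n, I u (c *: v + v') n = c *: I u v n + I u v' n).
Proof. by move=> [h1 h2]; split=> *; [rewrite h1|rewrite h2]. Qed.

Lemma bilin0 (A : Type) (U1 U2 U3 : lmodType R[i]) (I : U1 -> U2 -> A -> U3) :
  bilin I -> (forall v n, I 0 v n = 0) /\ (forall u n, I u 0 n = 0).
Proof.
move=> /bilinD [h1 h2]; split=> [v n|u n].
  have := h1 1 0 0 v n; rewrite !scale1r addr0 => /eqP.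
  by rewrite -subr_eq subrr eq_sym => /eqP.
have := h2 1 u 0 0 n; rewrite !scale1r addr0 => /eqP.
by rewrite -subr_eq subrr eq_sym => /eqP.
Qed.

Lemma bilin_lin (A : Type) (U1 U2 U3 : lmodType R[i]) c (I J : U1 -> U2 -> A -> U3) :
  bilin I -> bilin J -> bilin (fun u v n => c *: I u v n + J u v n).
Proof.
move=> /bilinD[hI hI'] /bilinD[hJ hJ']; split=> [v n|u n] d x y /=.
  by rewrite hI hJ !scalerDr !scalerA mulrC !addrA; congr (_ + _); rewrite addrAC.
by rewrite hI' hJ' !scalerDr !scalerA mulrC !addrA; congr (_ + _); rewrite addrAC.
Qed.

Lemma bilin_cst0 (A : Type) (U1 U2 U3 : lmodType R[i]) :
  bilin (fun (_ : U1) (_ : U2) (_ : A) => 0 : U3).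
Proof. by split=> [v n|u n] d x y /=; rewrite scaler0 addr0. Qed.

Lemma laurent_nat (M : lmodType R[i]) (f : int -> M) : in_laurent f ->
  forall n : int, exists N, forall i, (N <= i)%N -> f (n + i%:Z) = 0.
Proof.
move=> [N Nf] n; exists `|N - n|%N => i Ni; apply: Nf.
by rewrite addrC -lerBlDr (le_trans (ler_norm _))// -abszE lez_nat.
Qed.

Lemma jacobi_lin (A : pzRingType) (U1 U2 U3 : lmodType R[i])
    (Y1 : U1 -> int -> U1) (Y2 : U2 -> int -> U2) (Y3 : U3 -> int -> U3)
    c (I J : U1 -> U2 -> A -> U3) :
  (forall n, linear (Y3 ^~ n)) ->
  (forall u, in_laurent (Y1 u)) -> (forall v, in_laurent (Y2 v)) ->
  bilin I -> bilin J ->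
  (forall u v al, exists N, forall m, (N <= m)%N -> I u v (al + m%:R) = 0) ->
  (forall u v al, exists N, forall m, (N <= m)%N -> J u v (al + m%:R) = 0) ->
  jacobi Y1 Y2 Y3 I -> jacobi Y1 Y2 Y3 J ->
  jacobi Y1 Y2 Y3 (fun u v n => c *: I u v n + J u v n).
Proof.
move=> Y3l Y1t Y2t bI bJ It Jt jI jJ u v l m al.
have Y30 n : Y3 0 n = 0.
  have := Y3l n 1 0 0; rewrite /= !scale1r addr0 => /eqP.
  by rewrite -subr_eq subrr eq_sym => /eqP.
have {It} [NI NIP] := It u v al; have {Jt} [NJ NJP] := Jt u v al.
have [N1 N1P] := laurent_nat (Y1t u) l; have [N2 N2P] := laurent_nat (Y2t v) m.
have [I0 I0'] := bilin0 bI; have [J0 J0'] := bilin0 bJ.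
pose S1 (K : U1 -> U2 -> A -> U3) (i : nat) := ((-1) ^+ i * binz R l i) *:
   Y3 (K u v (al + i%:R)) (m + l - i%:Z).
pose S2 (K : U1 -> U2 -> A -> U3) (i : nat) :=
  ((-1) ^ l * (-1) ^+ i * binz R l i) *:
         K u (Y2 v (m + i%:Z)) (al + l%:~R - i%:R).
pose S3 (K : U1 -> U2 -> A -> U3) (i : nat) :=
  binz R m i *: K (Y1 u (l + i%:Z)) v (al + m%:~R - i%:R).
have fin1I : finite_set [set i | S1 I i <> 0].
  by apply: (@bounded_finite_supp _ _ _ NI) => i /NIP; rewrite /S1 => ->;
    rewrite Y30 scaler0.
have fin1J : finite_set [set i | S1 J i <> 0].
  by apply: (@bounded_finite_supp _ _ _ NJ) => i /NJP; rewrite /S1 => ->;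
    rewrite Y30 scaler0.
have fin2I : finite_set [set i | S2 I i <> 0].
  by apply: (@bounded_finite_supp _ _ _ N2) => i /N2P; rewrite /S2 => ->;
    rewrite I0' scaler0.
have fin2J : finite_set [set i | S2 J i <> 0].
  by apply: (@bounded_finite_supp _ _ _ N2) => i /N2P; rewrite /S2 => ->;
    rewrite J0' scaler0.
have fin3I : finite_set [set i | S3 I i <> 0].
  by apply: (@bounded_finite_supp _ _ _ N1) => i /N1P; rewrite /S3 => ->;
    rewrite I0 scaler0.
have fin3J : finite_set [set i | S3 J i <> 0].
  by apply: (@bounded_finite_supp _ _ _ N1) => i /N1P; rewrite /S3 => ->;
    rewrite J0 scaler0.
have -> : \sum_(i \in [set: nat]) S1 (fun u v n => c *: I u v n + J u v n) i =
    \sum_(i \in [set: nat]) (c *: S1 I i + S1 J i).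
  by apply: eq_fsbigr => i _; rewrite /S1 Y3l scalerDr !scalerA mulrC.
have -> : \sum_(i \in [set: nat]) S2 (fun u v n => c *: I u v n + J u v n) i =
    \sum_(i \in [set: nat]) (c *: S2 I i + S2 J i).
  by apply: eq_fsbigr => i _; rewrite /S2 scalerDr !scalerA mulrC.
have -> : \sum_(i \in [set: nat]) S3 (fun u v n => c *: I u v n + J u v n) i =
    \sum_(i \in [set: nat]) (c *: S3 I i + S3 J i).
  by apply: eq_fsbigr => i _; rewrite /S3 scalerDr !scalerA mulrC.
rewrite (fsum_lin c fin1I fin1J) (fsum_lin c fin2I fin2J) (fsum_lin c fin3I fin3J).
have hI : \sum_(i \in [set: nat]) S1 I i - \sum_(i \in [set: nat]) S2 I i =
  \sum_(i \in [set: nat]) S3 I i by exact: jI.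
have hJ : \sum_(i \in [set: nat]) S1 J i - \sum_(i \in [set: nat]) S2 J i =
  \sum_(i \in [set: nat]) S3 J i by exact: jJ.
by rewrite -hI -hJ scalerBr opprD addrACA.
Qed.

Lemma log_intertwining_submod : submod_closed (@log_intertwining_pred R V W1 W2 W3).
Proof.
have Y3l (a : V) n : linear ((@wmod_Y R V W3 a) ^~ n) by apply: (wmod_bilin W3).2.
split.
  rewrite unfold_in; apply/asboolP; split.
  - by move=> k; apply: bilin_cst0.
  - by move=> *; exists 0%N.
  - by move=> *; exists 0%N.
  - move=> a k u v l m al /=; rewrite [X in X - _]fsum0 ?[X in _ - X]fsum0 ?fsum0 ?subr0//.
    + by move=> i; rewrite scaler0.
    + by move=> i; rewrite scaler0.
    + by move=> i; rewrite (bilin0 (wmod_bilin W3)).2 scaler0.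
  - move=> u v; apply/funext => al; apply/funext => k.
    by rewrite /log_derivative /= !scaler0 addr0.
move=> c I J; rewrite !unfold_in => /asboolP[bI fI tI jI dI] /asboolP[bJ fJ tJ jJ dJ].
apply/asboolP; split.
- by move=> k; apply: (bilin_lin c (bI k) (bJ k)).
- move=> u v al; have [K KP] := fI u v al; have [L LP] := fJ u v al.
  exists (maxn K L) => k; rewrite geq_max => /andP[/KP hK /LP hL].
  by rewrite !fctE hK hL scaler0 addr0.
- move=> u v al; have [K KP] := tI u v al; have [L LP] := tJ u v al.
  exists (maxn K L) => m k; rewrite geq_max => /andP[/KP hK /LP hL].
  by rewrite !fctE hK hL scaler0 addr0.
- move=> a k; apply: jacobi_lin => //.
  + exact: wmod_trunc.
  + exact: wmod_trunc.
  + by move=> u v al; have [N NP] := tI u v al; exists N => m /NP.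
  + by move=> u v al; have [N NP] := tJ u v al; exists N => m /NP.
- move=> u v; apply/funext => al; apply/funext => k.
  have := congr1 (fun f => f al k) (dI u v); have := congr1 (fun f => f al k) (dJ u v).
  rewrite !fctE /log_derivative !fctE => -> ->.
  by rewrite !scalerDr !scalerA ![c * _]mulrC addrACA.
Qed.

HB.instance Definition _ := GRing.isSubmodClosed.Build R[i]
  (W1 -> W2 -> R[i] -> nat -> W3) (@log_intertwining_pred R V W1 W2 W3)
  log_intertwining_submod.

HB.instance Definition _ := [isSub for @I_log_val R V W1 W2 W3].
HB.instance Definition _ := [Choice of I_log W1 W2 W3 by <:].
HB.instance Definition _ := [SubChoice_isSubLmodule of I_log W1 W2 W3 by <:].

End LogClosed.

Section ZClosed.
Context {R : realType} {V : voa R} (W1 W2 W3 : ngmodule V).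

Lemma fsum_scale (I : choiceType) (M : lmodType R[i]) c (f : I -> M) :
  \sum_(i \in [set: I]) (c *: f i) = c *: \sum_(i \in [set: I]) f i.
Proof.
have [->|c0] := eqVneq c 0; first by rewrite scale0r fsum0// => i; rewrite scale0r.
have [ff|ff] := pselect (finite_set [set i | f i <> 0]).
  transitivity (\sum_(i \in [set: I]) (c *: f i + 0)).
    by apply: eq_fsbigr => i _; rewrite addr0.
  rewrite fsum_lin//; first by rewrite [X in _ + X]fsum0// addr0.
  by rewrite (_ : [set _ | _] = set0) ?finite_set0//; apply/seteqP; split.
rewrite !fsbig_dflt ?scaler0// setTI//; apply: contra_not ff.
by apply: sub_finite_set => i /= fi; apply: contra_not fi => /eqP;
  rewrite scaler_eq0 (negbTE c0) => /eqP.
Qed.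

Definition localized_scale (M : lmodType R[i]) (c : R[i]) (G : localized M) :
    localized M :=
  [seq Fraction (fun j k => c *: num F j k) (den_x F) (den_y F) (den_xy F) | F <- G].

Lemma expand_lin iota (M : lmodType R[i]) c (G H : localized M) s t :
  expand iota (localized_scale c G ++ H) s t =
  c *: expand iota G s t + expand iota H s t.
Proof.
rewrite /expand big_cat big_map scaler_sumr; congr (_ + _).
apply: eq_bigr => F _; rewrite -fsum_scale; apply: eq_fsbigr => jk _ /=.
by rewrite !scalerA mulrC.
Qed.

Lemma subspace_extend0 (M : lmodType R[i]) (D : nat -> set M) j :
  (forall i, subspace (D i)) -> subspace (extend0 D j).
Proof.
by case: j => [n /(_ n)//|n _]; split=> //= c u v -> ->; rewrite scaler0 addr0.
Qed.

Lemma Z_intertwining_submod : submod_closed (@Z_intertwining_pred R V W1 W2 W3).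
Proof.
have subs j : subspace (extend0 (ng_space W3) j).
  by apply: subspace_extend0; apply: (ng_direct_sum W3).1.
split.
  rewrite unfold_in; apply/asboolP; split.
  - exact: bilin_cst0.
  - by move=> *; exists 0.
  - by move=> i j k u v _ _; apply: (subs _).1.
  - move=> u v a; exists [::] => m n; rewrite /expand !big_nil; split=> //.
    by rewrite (bilin0 (wmod_bilin W3)).2.
move=> c I J; rewrite !unfold_in => /asboolP[bI tI gI lI] /asboolP[bJ tJ gJ lJ].
apply/asboolP; split.
- exact: (bilin_lin c bI bJ).
- move=> u v; have [N NP] := tI u v; have [L LP] := tJ u v.
  exists (Num.max N L) => n; rewrite ge_max => /andP[/NP hN /LP hL].
  by rewrite !fctE hN hL scaler0 addr0.
- move=> i j k u v ui vj; rewrite !fctE.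
  by apply: (subs _).2; [apply: gI|apply: gJ].
- move=> u v a; have [G GP] := lI u v a; have [H HP] := lJ u v a.
  exists (localized_scale c G ++ H) => m n; rewrite !expand_lin !fctE.
  have [-> -> ->] := GP m n; have [-> -> ->] := HP m n; split=> //.
  by rewrite (bilinD (wmod_bilin W3)).2.
Qed.

HB.instance Definition _ := GRing.isSubmodClosed.Build R[i]
  (W1 -> W2 -> int -> W3) (@Z_intertwining_pred R V W1 W2 W3)
  Z_intertwining_submod.

HB.instance Definition _ := [isSub for @I_Z_val R V W1 W2 W3].
HB.instance Definition _ := [Choice of I_Z W1 W2 W3 by <:].
HB.instance Definition _ := [SubChoice_isSubLmodule of I_Z W1 W2 W3 by <:].

End ZClosed.

Section L0Grading.
Context {R : realType} {V : voa R} (M : wmodule V).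
Implicit Types (a b : V) (w : M) (h : R[i]).

Lemma binz0 i : binz R 0 i = (i == 0%N)%:R.
Proof.
case: i => [|i]; first by rewrite /binz big_ord0 fact0 divr1.
by rewrite /binz big_ord_recl /= subrr mul0r mul0r.
Qed.

Lemma binz1 i : binz R 1 i = (i <= 1)%N%:R.
Proof.
case: i => [|[|i]]; first by rewrite /binz big_ord0 fact0 divr1.
  by rewrite /binz big_ord_recl big_ord0 /= mulr1 divr1.
by rewrite /binz 2!big_ord_recl /= subrr mul0r mulr0 mul0r.
Qed.

Lemma binzN2 i : binz R (-2) i = (-1) ^+ i * i.+1%:R.
Proof.
have fact_neq0 (n : nat) : (n`!)%:R != 0 :> R[i] by rewrite pnatr_eq0 -lt0n fact_gt0.
apply: (@mulIf _ (i`!)%:R) => //; rewrite divfK//.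
elim: i => [|i IH]; first by rewrite big_ord0 expr0 !mulr1.
rewrite big_ord_recr /= IH exprS factS !natrM rmorphB /= -!pmulrn.
by rewrite -[(-2)%:~R]/(- 2%:R) -[in i.+2%:R]addn1 -[in i.+1%:R]addn1 !natrD; ring.
Qed.

Lemma L1_vac a : voa_L (-1) a = voa_Y a (vac V) (-2).
Proof.
have := voa_deriv a (vac V) (-1).
by rewrite voa_creation_lim opprK scale1r.
Qed.

Lemma wmod_deriv a w k :
  wmod_Y (voa_L (-1) a) w k = (- k)%:~R *: wmod_Y a w (k - 1).
Proof.
have Y0 n : wmod_Y a (0 : M) n = 0 by rewrite (bilin0 (wmod_bilin M)).2.
rewrite L1_vac; have := wmod_jacobi a (vac V) w (-2) 0 k.
rewrite [X in _ = X -> _](@fsum_single _ _ _ 0%N); last first.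
  by move=> i /eqP/negbTE i0; rewrite binz0 i0 scale0r.
have -> : k + 0%:~R - 0%:R = k :> int by rewrite subr0 addr0.
rewrite binz0 eqxx scale1r addr0 => <-.
have s2 : ((-1) ^ (-2) : R[i]) = 1 by rewrite -[LHS]/(((-1) ^+ 2)^-1) sqrrN expr1n invr1.
under [X in _ - X]eq_fsbigr => i _ do rewrite binzN2 wmod_vac s2 mul1r mulrA -expr2
   -exprM mulnC exprM sqrrN !expr1n mul1r intz natz.
under [X in X - _]eq_fsbigr => i _ do rewrite binzN2 wmod_vac mulrA -expr2
   -exprM mulnC exprM sqrrN !expr1n mul1r natz !add0r.
have [k0|k0] := leP 1 k.
  rewrite [X in X - _]fsum0 => [|i]; last first.
    rewrite ifF ?Y0 ?scaler0//; apply/negbTE/eqP => /eqP.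
    by rewrite -subr_eq0 => /eqP; lia.
  have -> : k = (`|k|.-1.+1)%:Z by lia.
  rewrite (@fsum_single _ _ _ `|k|.-1) => [|i ik]; last first.
    by rewrite ifF ?scaler0//; apply/negbTE/eqP; lia.
  rewrite ifT; last by apply/eqP; lia.
  rewrite !add0r -scaleNr; congr (_ *: _); last by congr (wmod_Y _ _ _); lia.
rewrite [X in _ - X]fsum0 => [|i]; last first.
  by case: eqP => [|_]; [rewrite natz; lia|rewrite scaler0].
rewrite subr0; have [->|kn0] := eqVneq k 0.
  rewrite oppr0 scale0r; apply: fsum0 => i.
  by case: eqP => [|_]; [lia|rewrite Y0 scaler0].
have kE : k = - (`|k|.-1.+1)%:Z by lia.
rewrite (@fsum_single _ _ _ `|k|.-1) => [|i ik]; last first.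
  by rewrite ifF ?Y0 ?scaler0//; apply/negbTE/eqP; lia.
rewrite ifT; last by apply/eqP; lia.
congr (_ *: _); last by congr (wmod_Y _ _ _); lia.
by rewrite [in RHS]kE opprK.
Qed.

Lemma L0_comm (p : int) a k w : wt_space p a ->
  wmod_L 0 (wmod_Y a w k) - wmod_Y a (wmod_L 0 w) k =
  (p - k - 1)%:~R *: wmod_Y a w k.
Proof.
move=> /voa_wt pa; have := wmod_jacobi (omega V) a w 0 1 k.
have Y0 n : wmod_Y a (0 : M) n = 0 by rewrite (bilin0 (wmod_bilin M)).2.
rewrite [X in X - _ = _ -> _](@fsum_single _ _ _ 0%N); last first.
  by move=> i /eqP/negbTE i0; rewrite binz0 i0 mulr0 scale0r.
rewrite [X in _ - X = _ -> _](@fsum_single _ _ _ 0%N); last first.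
  by move=> i /eqP/negbTE i0; rewrite binz0 i0 mulr0 scale0r.
rewrite [X in _ = X -> _](@fsum_widen _ _ _ 2); last first.
  by move=> i i2; rewrite binz1 leqNgt i2 scale0r.
rewrite 2!big_ord_recl big_ord0 !binz0 !binz1 eqxx /= /bump /=.
rewrite !expr0 expr0z !mul1r !scale1r !addr0 ?subr0 ?intz.
rewrite /wmod_L !add0r => ->; rewrite addn0 addrK.
have := wmod_deriv a w (k + 1); rewrite /voa_L addNr => ->.
rewrite -[voa_Y _ a 1]/(voa_L 0 a) pa addrK.
have -> : wmod_Y (p%:~R *: a) w k = p%:~R *: wmod_Y a w k.
  have := (bilinD (wmod_bilin M)).1 p%:~R a 0 w k.
  by rewrite (bilin0 (wmod_bilin M)).1 !addr0.
by rewrite -scalerDl -rmorphD /=; congr (_%:~R *: _); lia.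
Qed.

Lemma L0_shift (p : int) a k w h n : wt_space p a ->
  iter n (fun w => wmod_L 0 w - (h + (p - k - 1)%:~R) *: w) (wmod_Y a w k) =
  wmod_Y a (iter n (fun w => wmod_L 0 w - h *: w) w) k.
Proof.
move=> pa; elim: n => //= n ->; move: (iter _ _ _) => {}w.
have /eqP := L0_comm k w pa; rewrite subr_eq => /eqP ->.
have -> : wmod_L 0 w - h *: w = - h *: w + wmod_L 0 w by rewrite scaleNr addrC.
rewrite (bilinD (wmod_bilin M)).2 scalerDl scaleNr.
set x := _%:~R *: _; set y := h *: _; set z := wmod_Y a (wmod_L 0 w) k.
by rewrite [x + z]addrC opprD addrACA subrr addr0 addrC.
Qed.

Lemma gen_eigenspace_act (p : int) a k w h : wt_space p a ->
  gen_eigenspace M h w ->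
  gen_eigenspace M (h + (p - k - 1)%:~R) (wmod_Y a w k).
Proof.
move=> pa [n [n0 nw]]; exists n; split=> //.
by rewrite L0_shift// nw (bilin0 (wmod_bilin M)).2.
Qed.

Let T h w := wmod_L 0 w - h *: w.

Lemma T_lin h c w w' : T h (c *: w + w') = c *: T h w + T h w'.
Proof.
rewrite /T /wmod_L (bilinD (wmod_bilin M)).2 scalerDr scalerBr !scalerA mulrC.
by rewrite opprD addrACA.
Qed.

Lemma iterT_lin n h c w w' :
  iter n (T h) (c *: w + w') = c *: iter n (T h) w + iter n (T h) w'.
Proof. by elim: n => //= n ->; rewrite T_lin. Qed.

Lemma iterT0 n h : iter n (T h) 0 = 0.
Proof. by have := iterT_lin n h (-1) 0 0; rewrite !scaleN1r oppr0 addr0 addNr. Qed.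

Lemma T_comm h h' w : T h (T h' w) = T h' (T h w).
Proof.
have L (c : R[i]) x : wmod_L 0 (wmod_L 0 x - c *: x) =
    wmod_L 0 (wmod_L 0 x) - c *: wmod_L 0 x :> M.
  by rewrite addrC -scaleNr /wmod_L (bilinD (wmod_bilin M)).2 scaleNr addrC.
rewrite /T !L !scalerBr !scalerA !opprB [h' * h]mulrC.
by rewrite [LHS]addrAC [RHS]addrAC !addrA addrAC; congr (_ - _); rewrite addrAC addrA addrAC.
Qed.

Lemma iterT_comm n h h' w : iter n (T h) (T h' w) = T h' (iter n (T h) w).
Proof. by elim: n => //= n ->; rewrite T_comm. Qed.

Lemma T_coprime h h' n m w : h != h' ->
  iter n (T h) w = 0 -> iter m (T h') w = 0 -> w = 0.
Proof.
move=> hh'; elim: n w => //= n IH w nw mw.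
have Tw : T h w = 0.
  apply: IH; first by rewrite iterT_comm.
  by rewrite iterT_comm mw; have := iterT0 1 h.
have TE : T h' w = (h - h') *: w.
  by rewrite /T scalerBl; congr (_ - _); apply/eqP; rewrite -subr_eq0; apply/eqP.
have : iter m (T h') w = (h - h') ^+ m *: w.
  elim: m {IH mw} => [|m IHm]; first by rewrite expr0 scale1r.
  rewrite iterSr TE; have := iterT_lin m h' (h - h') w 0.
  by rewrite iterT0 !addr0 => ->; rewrite IHm scalerA exprS.
by rewrite mw => /esym/eqP; rewrite scaler_eq0 expf_eq0 subr_eq0 (negbTE hh') andbF
  => /eqP.
Qed.

Lemma gen_eigenspace0 lam h : L0_decomposed M lam ->
  (forall j : nat, h != lam + j%:R) -> gen_eigenspace M h `<=` [set 0].
Proof.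
move=> [subs dec] hlam w [n [_ nw]] /=.
have [f [[ff fD fw] _]] := dec w.
have Tsum (c : R[i]) (g : nat -> M) : finite_set [set i | g i <> 0] ->
   iter n (T h) (\sum_(i \in [set: nat]) g i) =
   \sum_(i \in [set: nat]) iter n (T h) (g i).
  move=> fg; have [s sE] := finite_fsetP.1 fg.
  have wid (g' : nat -> M) : (forall i, g i = 0 -> g' i = 0) ->
      \sum_(i \in [set: nat]) g' i = \sum_(i \in [set i | g i <> 0]) g' i.
    by move=> h0; symmetry; apply: fsbig_widen => // i [_ /= /contrapT /h0].
  rewrite !wid//; last by move=> i ->; rewrite iterT0.
  rewrite !fsbig_finite//=; elim/big_rec2 : _ => [|i y1 y2 _ <-]; first by rewrite iterT0.
  by have := iterT_lin n h 1 (g i) y2; rewrite !scale1r.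
have f0 : (fun i => iter n (T h) (f i)) = (fun=> 0).
  have [f' [[_ _ _] uf']] := dec 0.
  transitivity f'; [symmetry|]; apply: uf'; split.
  - apply: sub_finite_set ff => i /=; apply: contra_not => ->; exact: iterT0.
  - move=> i; have [m [m0 mf]] := fD i; exists m; split=> //.
    rewrite -[LHS]/(iter m (T (lam + i%:R)) (iter n (T h) (f i))).
    have -> k : iter m (T (lam + i%:R)) (iter k (T h) (f i)) =
        iter k (T h) (iter m (T (lam + i%:R)) (f i)).
      by elim: k => //= k IH; rewrite iterT_comm IH.
    by rewrite [X in iter _ _ X]mf iterT0.
  - by rewrite -Tsum// -fw [RHS]nw.
  - by rewrite (_ : [set _ | _] = set0) ?finite_set0//; apply/seteqP; split.
  - by move=> i; apply: (subs i).1.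
  - by rewrite fsum0.
rewrite fw fsum0// => i; have [m [_ mf]] := fD i.
exact: (@T_coprime _ _ n m _ (hlam i) (congr1 (fun g => g i) f0) mf).
Qed.

Lemma L0_graded_act lam : L0_decomposed M lam ->
  forall (p : int) a (j : nat) (k : int) w,
    wt_space p a -> gen_eigenspace M (lam + j%:R) w ->
    extend0 (fun j : nat => gen_eigenspace M (lam + j%:R)) (p + j%:Z - k - 1)
            (wmod_Y a w k).
Proof.
move=> dec p a j k w pa jw.
have := gen_eigenspace_act k pa jw.
have -> : lam + j%:R + (p - k - 1)%:~R = lam + (p + j%:Z - k - 1)%:~R.
  rewrite -addrA pmulrn -rmorphD /=; congr (_ + _%:~R); lia.
case: (p + j%:Z - k - 1) => n //=.
apply: (gen_eigenspace0 dec) => i; rewrite (inj_eq (addrI lam)) pmulrn eqr_int.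
by [].
Qed.

(* M(j) = (M)_(lam+j). *)
Definition L0_graded lam (dec : L0_decomposed M lam) : ngmodule V :=
  NGModule dec (L0_graded_act dec).

End L0Grading.

(* Main.v *)
(* Write lam = lam1 + lam2 - lam3 and, for a Z-graded operator Phi, let delta Phi
   be L(0) Phi(u,x)v - Phi(L(0)u,x)v - Phi(u,x)L(0)v - x d/dx Phi(u,x)v + lam Phi(u,x)v.
   The L(-1)-derivative property of a logarithmic operator says exactly that
   (k+1) I^(k+1) = delta I^(k) after the shift by x^lam, so I is recovered from
   I^o as exp(log x delta) I^o; conversely delta preserves the grading and the
   Jacobi identity, and it is locally nilpotent since delta is a sum of commuting
   operators L(0) - h that are locally nilpotent on homogeneous vectors.  It remains
   to see that, for truncated series, the Jacobi identity is equivalent to the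
   existence of a common localization of the three products.  One direction is a
   residue identity for the monomials x^j y^k (x-y)^l, which by the Vandermonde
   convolution is an identity between binomial coefficients.  In the other one,
   the Jacobi identity gives weak commutativity (x-y)^r P = (x-y)^r Q, so that the
   common value has a numerator in M[[x,y]], and the third product is determined
   by the first two. *)
From HB Require Import structures.
Require Import Defs.
From mathcomp Require Import all_boot all_order all_algebra.
From mathcomp Require Import boolp classical_sets functions cardinality fsbigop.
From mathcomp Require Import reals complex ring zify.

Set Implicit Arguments.
Unset Strict Implicit.
Unset Printing Implicit Defensive.

Import Order.TTheory GRing.Theory Num.Theory.
Local Open Scope classical_set_scope.
Local Open Scope ring_scope.

(** * Binomial coefficients with integral lower index, and the residue identity *)

Section Binomials.
Context {R : realType}.
Implicit Types (a b n d k : int).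

(** Extension by zero to negative lower indices removes the boundary cases from Pascal's rule and
    lets convolution sums run past the last nonzero term. *)
Definition zbin (a n : int) : R[i] := if n is Posz i then binz R a i else 0.

Lemma binz0r a : binz R a 0 = 1.
Proof. by rewrite /binz big_ord0 fact0 divr1. Qed.

Lemma binzS a i : binz R (a + 1) i.+1 = binz R a i.+1 + binz R a i.
Proof.
have fact_neq0 (n : nat) : (n`!)%:R != 0 :> R[i] by rewrite pnatr_eq0 -lt0n fact_gt0.
apply: (@mulIf _ (i.+1`!)%:R) => //; rewrite mulrDl !divfK//.
rewrite big_ord_recl big_ord_recr /= subr0.
under eq_bigr => j _ do rewrite /bump /= add1n -addn1 PoszD opprD addrACA subrr addr0.
set p := \prod_(j < i) _; rewrite /binz -/p factS natrM !rmorphB !rmorphD /= -!pmulrn.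
rewrite -[i.+1]addn1 natrD.
by field; apply: fact_neq0.
Qed.

Lemma zbinS a n : zbin (a + 1) n = zbin a n + zbin a (n - 1).
Proof.
case: n => [[|i]|i].
- by rewrite /= !binz0r addr0.
- by rewrite (_ : Posz i.+1 - 1 = Posz i) /= ?binzS//; lia.
- by rewrite (_ : Negz i - 1 = Negz i.+1) /= ?addr0//; lia.
Qed.

Lemma zbin_lt0 a n : n < 0 -> zbin a n = 0.
Proof. by case: n. Qed.

Lemma zbin0 n : zbin 0 n = (n == 0)%:R.
Proof. by case: n => [i|i] //=; rewrite binz0. Qed.

Lemma zbin_pred a n : zbin a n = zbin (a + 1) n - zbin a (n - 1).
Proof. by rewrite zbinS addrK. Qed.

(** Pascal's rule in the upper entry [a] reduces the claim to a = 0, where a single term survives.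
    The bound [B] only has to exceed [n], since [zbin b] vanishes at negative arguments. *)
Lemma vandermonde a b n (B : nat) : n < B%:Z ->
  \sum_(i < B) binz R a i * zbin b (n - i%:Z) = zbin (a + b) n.
Proof.
have neg a' (B' : nat) n' : n' < 0 ->
    \sum_(i < B') binz R a' i * zbin b (n' - i%:Z) = zbin (a' + b) n'.
  move=> n0; rewrite zbin_lt0// big1// => i _.
  by rewrite zbin_lt0 ?mulr0//; lia.
have base (B' : nat) n' : n' < B'%:Z ->
    \sum_(i < B') binz R 0 i * zbin b (n' - i%:Z) = zbin (0 + b) n'.
  have [/neg //|n0] := ltP n' 0; case: B' => [|B' _]; first by lia.
  rewrite big_ord_recl big1 => [|i _]; last by rewrite binz0 mul0r.
  by rewrite binz0r mul1r subr0 add0r addr0.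
have step a' (B' : nat) n' : \sum_(i < B'.+1) binz R (a' + 1) i * zbin b (n' - i%:Z) =
    \sum_(i < B'.+1) binz R a' i * zbin b (n' - i%:Z) +
    \sum_(i < B') binz R a' i * zbin b (n' - 1 - i%:Z).
  rewrite big_ord_recl [in RHS]big_ord_recl !binz0r -addrA -big_split /=.
  congr (_ + _); apply: eq_bigr => i _; rewrite /bump /= add1n binzS mulrDl.
  by congr (_ + _ * zbin _ _); lia.
elim/int_ind: a n B => [|a IH|a IH] n B nB; first exact: base.
  have [/neg //|n0] := ltP n 0; case: B nB => [|B] nB; first by lia.
  have -> : Posz a.+1 = Posz a + 1 by lia.
  rewrite step !IH; try lia.
  by rewrite [_ + 1 + b]addrAC zbinS.
have -> : - (a.+1)%:Z = - a%:Z - 1 by lia.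
(* Solved for the upper entry -a - 1, [step] involves that same entry at n - 1. Descending in [a]
   therefore needs an inner induction on a bound [m] for [n], which starts at negative [n]. *)
suff: forall m : nat, forall n : int, n < m%:Z -> forall B : nat, n < B%:Z ->
    \sum_(i < B) binz R (- a%:Z - 1) i * zbin b (n - i%:Z) = zbin (- a%:Z - 1 + b) n.
  by move/(_ `|n|.+1 n); apply; lia.
elim=> [|m IHm] {nB} {}n nm {}B nB; first by apply: neg.
have [/neg //|n0] := ltP n 0; case: B nB => [|B] nB; first by lia.
have := step (- a%:Z - 1) B n; rewrite subrK IH// (IHm (n - 1)); [|by lia..].
move=> /eqP; rewrite -subr_eq => /eqP <-.
by rewrite [RHS]zbin_pred; congr (zbin _ _ - _); lia.
Qed.

Lemma zbin_sym (d : nat) n : zbin d n = zbin d (d%:Z - n).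
Proof.
elim: d n => [|d IH] n; first by rewrite !zbin0 sub0r oppr_eq0.
have -> : Posz d.+1 = Posz d + 1 by lia.
rewrite !zbinS [LHS]addrC IH; congr (_ + _); first by congr zbin; lia.
by rewrite IH; congr zbin; lia.
Qed.

Definition zsign (n : int) : R[i] := (-1) ^ n.

Lemma zsignD m n : zsign (m + n) = zsign m * zsign n.
Proof. by rewrite /zsign expfzDr// oppr_eq0 oner_eq0. Qed.

Lemma zsign1 : zsign 1 = -1.
Proof. by rewrite /zsign expr1z. Qed.

Lemma zsign_nat (n : nat) : zsign n = (-1) ^+ n.
Proof. by rewrite /zsign -exprnP. Qed.

Lemma zsignN n : zsign (- n) = zsign n.
Proof. by rewrite /zsign -exprz_inv invrN1. Qed.

Lemma zsign_sqr n : zsign n * zsign n = 1.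
Proof. by rewrite -[X in _ * X]zsignN -zsignD subrr /zsign expr0z. Qed.

(* The residue identity Res_y (iota_yx - iota_xy) = Res_(y-x) iota_xz, on the
   monomial y^k (x-y)^d. *)
Lemma zbin_residue d k :
  zsign (k + d + 1) * (zbin d (k + d + 1) - zbin d (- 1 - k)) = zbin k (- 1 - d).
Proof.
(* Both sides satisfy f(d, k+1) = f(d, k) + f(d+1, k), vanish for d >= 0 and agree at k = 0 for d <
   0. Descending in d, and for each d moving k both ways from 0, these facts determine them. *)
pose g d k := zsign (k + d + 1) * (zbin d (k + d + 1) - zbin d (- 1 - k)).
pose h d k := zbin k (- 1 - d).
have gS d' k' : g d' (k' + 1) = g d' k' + g (d' + 1) k'.
  rewrite /g (_ : k' + 1 + d' + 1 = k' + d' + 1 + 1); last by lia.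
  rewrite (_ : k' + (d' + 1) + 1 = k' + d' + 1 + 1); last by lia.
  rewrite !zbinS zsignD zsign1 addrK.
  rewrite (_ : - 1 - (k' + 1) = - 1 - k' - 1); last by lia.
  by ring.
have hS d' k' : h d' (k' + 1) = h d' k' + h (d' + 1) k'.
  by rewrite /h zbinS; congr (_ + zbin _ _); lia.
have g0 (d' : nat) k' : g d' k' = 0.
  by rewrite /g zbin_sym (_ : _ - _ = - 1 - k') ?subrr ?mulr0//; lia.
have h0 (d' : nat) k' : h d' k' = 0 by rewrite /h zbin_lt0//; lia.
have gh0 d' : d' < 0 -> g d' 0 = h d' 0.
  move=> d0; rewrite /g /h zbin0 add0r.
  rewrite (@zbin_lt0 d' (- 1 - 0))// subr0.
  have [->|dN] := eqVneq d' (-1); first by rewrite /zsign expr0z mul1r /= binz0r.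
  rewrite zbin_lt0 ?mulr0; last by lia.
  by case: eqP => //; lia.
case: d => [d|d]; first exact: etrans (g0 d k) (esym (h0 d k)).
rewrite NegzE -[LHS]/(g _ k) -[RHS]/(h _ k); elim: d.+1 k => [|{}d IH] k.
  by rewrite oppr0 (g0 0%N) (h0 0%N).
have {}IH k' : g (- d.+1%:Z + 1) k' = h (- d.+1%:Z + 1) k'.
  by rewrite (_ : _ + 1 = - d%:Z) ?IH//; lia.
elim/int_ind: k => [|k IHk|k IHk]; first by apply: gh0; lia.
  have -> : Posz k.+1 = Posz k + 1 by lia.
  by rewrite gS hS IHk IH.
apply: (addIr (g (- d.+1%:Z + 1) (- k.+1%:Z))); rewrite -gS [in RHS]IH -hS.
by rewrite (_ : _ + 1 = - k%:Z) ?IHk//; lia.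
Qed.

End Binomials.

(** * Expansions of localized elements satisfy the Jacobi identity *)

Section Expansions.
Context {R : realType}.
Implicit Types (M : lmodType R[i]).

(** By homogeneity an expansion of x^j y^k (x-y)^l lives in total degree j + k + l, and there its
    coefficients depend only on k, l and the second exponent t. These three functions are those
    coefficients. *)
Definition weight_xy (k l t : int) : R[i] := zsign (t - k) * zbin l (t - k).
Definition weight_yx (k l t : int) : R[i] := zsign (t - k) * zbin l (k + l - t).
Definition weight_xz (k l t : int) : R[i] := zsign l * zbin k (t - l).

Definition has_weight (iota : int -> int -> int -> int -> int -> R[i])
    (w : int -> int -> int -> R[i]) :=
  forall j k l s t : int, iota j k l s t = if s + t == j + k + l then w k l t else 0.

Lemma fsum_at (D : set nat) (e : int) (f : nat -> R[i]) :
  (forall i : nat, D i <-> e = i%:Z) ->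
  \sum_(i \in D) f i = if e is Posz i then f i else 0.
Proof.
move=> De; case: e De => [e|e] De.
  rewrite (_ : D = [set e]) ?fsbig_set1//; apply/seteqP; split=> i /=.
    by move/De => [].
  by move=> ->; apply/De.
by apply: fsbig1 => i /De.
Qed.

Lemma iota_xy_weight : has_weight (@iota_xy R) weight_xy.
Proof.
move=> j k l s t; case: eqP => st; last first.
  by apply: fsbig1 => i [? ?]; case: st; lia.
rewrite /iota_xy (@fsum_at _ (t - k)) => [|i]; last by split=> [[? ?]|?]; [|split]; lia.
rewrite /weight_xy; case: (t - k) => [i|i]; last by rewrite mulr0.
by rewrite zsign_nat mulrC.
Qed.

Lemma iota_yx_weight : has_weight (@iota_yx R) weight_yx.
Proof.
move=> j k l s t; case: eqP => st; last first.
  by apply: fsbig1 => i [? ?]; case: st; lia.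
rewrite /iota_yx (@fsum_at _ (k + l - t)) => [|i]; last by split=> [[? ?]|?]; [|split]; lia.
rewrite /weight_yx (_ : t - k = l - (k + l - t)); last by lia.
case: (k + l - t) => [i|i]; last by rewrite mulr0.
by rewrite /zsign mulrC.
Qed.

Lemma iota_xz_weight : has_weight (@iota_xz R) weight_xz.
Proof.
move=> j k l s t; case: eqP => st; last first.
  by apply: fsbig1 => i [? ?]; case: st; lia.
rewrite /iota_xz (@fsum_at _ (t - l)) => [|i]; last by split=> [[? ?]|?]; [|split]; lia.
rewrite /weight_xz; case: (t - l) => [i|i]; last by rewrite mulr0.
by rewrite mulrC.
Qed.

(** Numerators are extended by zero to negative powers of x, so that an antidiagonal can be indexed
    by the power of y alone. *)
Definition num_int M (f : nat -> nat -> M) (j : int) (k : nat) : M :=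
  if j is Posz i then f i k else 0.

Lemma fsum_antidiagonal M (w : nat -> R[i]) (f : nat -> nat -> M) (N : int) (K : nat) :
  N < K%:Z ->
  \sum_(jk \in [set: nat * nat])
     (if N == jk.1%:Z + jk.2%:Z then w jk.2 else 0) *: f jk.1 jk.2 =
  \sum_(k < K) w k *: num_int f (N - k%:Z) k.
Proof.
move=> NK; case: N NK => [N|N] NK; last first.
  rewrite fsum0 => [|[j k]]; last by rewrite /= scale0r.
  rewrite big1// => i _; rewrite /num_int.
  by case E: (Negz N - i%:Z) => [e|e]; [lia|rewrite scaler0].
transitivity (\sum_(jk \in (fun k : nat => ((N - k)%N, k)) @` `I_K)
   (if N%:Z == jk.1%:Z + jk.2%:Z then w jk.2 else 0) *: f jk.1 jk.2).
  symmetry; apply: fsbig_widen => // -[j k] [_ /= jk].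
  case: eqP => [E|_]; last by rewrite scale0r.
  by case: jk => /=; exists k; [lia|congr pair; lia].
rewrite fsbig_image => [|i j _ _ [_ //]].
rewrite (@fsbig_ord _ _ _ K (fun k : nat => w k *: num_int f (N%:Z - k%:Z) k)).
apply: eq_fsbigr => k _ /=; have [kN|Nk] := leqP k N.
  by rewrite (_ : N%:Z - k%:Z = Posz (N - k)%N) ?ifT//=; [apply/eqP|]; lia.
rewrite ifF ?scale0r; last by apply/eqP; lia.
by case E: (N%:Z - k%:Z) => [e|e]; [lia|rewrite scaler0].
Qed.

Definition degree M (F : fraction M) : int := ((den_x F)%:Z + (den_y F)%:Z + (den_xy F)%:Z).

(** For fixed s and t only one antidiagonal of the numerator contributes, which makes the expansion
    a finite sum; any sufficiently large range [K] gives the same value. *)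
Lemma expand1 iota w M (F : fraction M) s t (K : nat) : has_weight iota w ->
  s + t + degree F < K%:Z ->
  expand iota [:: F] s t =
  \sum_(k < K) w (k%:Z - (den_y F)%:Z) (- (den_xy F)%:Z) t *:
     num_int (num F) (s + t + degree F - k%:Z) k.
Proof.
move=> wP sK; rewrite /expand big_seq1.
rewrite -(fsum_antidiagonal (fun k : nat => w (k%:Z - _) _ t))//.
apply: eq_fsbigr => -[j k] _ /=; rewrite wP /degree; congr (_ *: _).
by congr (if _ then _ else _); apply/eqP/eqP; lia.
Qed.

(** [P], [Q], [S] stand for the modes of I(u,x)Y(a,y)v, Y(a,y)I(u,x)v and I(Y(a,y-x)u,x)v, the first
    index belonging to x. The value is the defect of the Jacobi identity with each sum cut off at
    [B]; being finite, it is linear in the triple without any support condition. *)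
Definition jacobi_sum M (P Q S : int -> int -> M) (l m n : int) (B : nat) : M :=
  \sum_(i < B) ((-1) ^+ i * binz R l i) *: Q (n + i%:Z) (m + l - i%:Z)
  - \sum_(i < B) ((-1) ^ l * (-1) ^+ i * binz R l i) *: P (n + l - i%:Z) (m + i%:Z)
  - \sum_(i < B) binz R m i *: S (n + m - i%:Z) (l + i%:Z).

(** For truncated series the omitted terms vanish once [B] is large, so this is then the Jacobi
    identity itself. *)
Definition jacobi_eventually M (P Q S : int -> int -> M) :=
  forall l m n, exists B0 : nat, forall B, (B0 <= B)%N -> jacobi_sum P Q S l m n B = 0.

Lemma jacobi_sum_lin M c (P Q S P' Q' S' : int -> int -> M) l m n B :
  jacobi_sum (fun i j => c *: P i j + P' i j) (fun i j => c *: Q i j + Q' i j)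
             (fun i j => c *: S i j + S' i j) l m n B =
  c *: jacobi_sum P Q S l m n B + jacobi_sum P' Q' S' l m n B.
Proof.
have sum_lin (d : nat -> R[i]) (F G : nat -> M) :
    \sum_(i < B) d i *: (c *: F i + G i) =
    c *: (\sum_(i < B) d i *: F i) + \sum_(i < B) d i *: G i.
  rewrite scaler_sumr -big_split; apply: eq_bigr => i _ /=.
  by rewrite scalerDr !scalerA mulrC.
rewrite /jacobi_sum.
have /= -> := sum_lin (fun i => (-1) ^+ i * binz R l i)
  (fun i => Q (n + i%:Z) (m + l - i%:Z)) (fun i => Q' (n + i%:Z) (m + l - i%:Z)).
have /= -> := sum_lin (fun i => (-1) ^ l * (-1) ^+ i * binz R l i)
  (fun i => P (n + l - i%:Z) (m + i%:Z)) (fun i => P' (n + l - i%:Z) (m + i%:Z)).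
have /= -> := sum_lin (fun i => binz R m i)
  (fun i => S (n + m - i%:Z) (l + i%:Z)) (fun i => S' (n + m - i%:Z) (l + i%:Z)).
rewrite !scalerBr !opprD.
by rewrite [X in X + _ = _]addrACA [LHS]addrACA.
Qed.

Lemma eq_jacobi_sum M (P Q S P' Q' S' : int -> int -> M) l m n B :
  P =2 P' -> Q =2 Q' -> S =2 S' ->
  jacobi_sum P Q S l m n B = jacobi_sum P' Q' S' l m n B.
Proof.
move=> PE QE SE; rewrite /jacobi_sum; congr (_ - _ - _); apply: eq_bigr => i _.
- by rewrite QE.
- by rewrite PE.
- by rewrite SE.
Qed.

Lemma jacobi_eventually_lin M c (P Q S P' Q' S' : int -> int -> M) :
  jacobi_eventually P Q S -> jacobi_eventually P' Q' S' ->
  jacobi_eventually (fun i j => c *: P i j + P' i j) (fun i j => c *: Q i j + Q' i j)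
             (fun i j => c *: S i j + S' i j).
Proof.
move=> J J' l m n; have [B0 JB] := J l m n; have [B1 JB'] := J' l m n.
exists (maxn B0 B1) => B; rewrite geq_max => /andP[/JB E /JB' E'].
by rewrite jacobi_sum_lin E E' scaler0 addr0.
Qed.

Lemma expand_cons iota M (F : fraction M) G s t :
  expand iota (F :: G) s t = expand iota [:: F] s t + expand iota G s t.
Proof. by rewrite /expand big_cons big_seq1. Qed.

(** Vandermonde collapses the three sums to single binomials, with upper entries l + r, l + r and m
    + k. What remains is [zbin_residue] at d = l + r, with m + k in place of k. *)
Lemma jacobi_weights (k r l m : int) (B : nat) :
  m + l + 1 + k + r < B%:Z -> - m - 1 - k < B%:Z -> - l - 1 - r < B%:Z ->
  \sum_(i < B) (-1) ^+ i * binz R l i * weight_yx k r (- (m + l - i%:Z) - 1)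
  - \sum_(i < B) (-1) ^ l * (-1) ^+ i * binz R l i * weight_xy k r (- (m + i%:Z) - 1)
  - \sum_(i < B) binz R m i * weight_xz k r (- (l + i%:Z) - 1) = 0.
Proof.
move=> B1 B2 B3.
have sqr_cancel (x y c z : R[i]) (i : int) : x * zsign i * c * (zsign i * y * z) = x * y * (c * z).
  by rewrite -[RHS]mul1r -(zsign_sqr i); ring.
have -> : \sum_(i < B) (-1) ^+ i * binz R l i * weight_yx k r (- (m + l - i%:Z) - 1) =
    zsign (m + l + 1 + k) * zbin (l + r) (m + l + 1 + k + r).
  rewrite -(@vandermonde _ _ _ _ B)// mulr_sumr; apply: eq_bigr => i _.
  rewrite /weight_yx (_ : k + r - _ = m + l + 1 + k + r - i%:Z); last by lia.
  rewrite (_ : - (m + l - i%:Z) - 1 - k = i%:Z + - (m + l + 1 + k)); last by lia.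
  by rewrite zsignD zsignN -zsign_nat -[zsign i * binz R l i]mul1r mulrA sqr_cancel mul1r.
have -> : \sum_(i < B) (-1) ^ l * (-1) ^+ i * binz R l i *
      weight_xy k r (- (m + i%:Z) - 1) =
    zsign (m + l + 1 + k) * zbin (l + r) (- m - 1 - k).
  rewrite -(@vandermonde _ _ _ _ B)// mulr_sumr; apply: eq_bigr => i _.
  rewrite /weight_xy (_ : _ - 1 - k = - (i%:Z + (m + 1 + k))); last by lia.
  rewrite zsignN zsignD -[(-1) ^ l]/(zsign l) -zsign_nat.
  rewrite (_ : m + l + 1 + k = l + (m + 1 + k)) ?[zsign (l + _)]zsignD; last by lia.
  rewrite (_ : - (i%:Z + _) = - m - 1 - k - i%:Z); last by lia.
  by rewrite sqr_cancel.
have -> : \sum_(i < B) binz R m i * weight_xz k r (- (l + i%:Z) - 1) =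
    zsign r * zbin (m + k) (- l - 1 - r).
  rewrite -(@vandermonde _ _ _ _ B)// mulr_sumr; apply: eq_bigr => i _.
  rewrite /weight_xz mulrCA; congr (_ * (_ * zbin _ _)); lia.
rewrite -mulrBr; apply/eqP; rewrite subr_eq0; apply/eqP.
have -> : - l - 1 - r = - 1 - (l + r) by lia.
have -> : m + l + 1 + k + r = m + k + (l + r) + 1 by lia.
have -> : - m - 1 - k = - 1 - (m + k) by lia.
rewrite -(zbin_residue (l + r) (m + k)) mulrA -zsignD; congr (_ * _).
have -> : r + (m + k + (l + r) + 1) = (m + l + 1 + k) + (r + r) by lia.
by rewrite [RHS]zsignD [zsign (r + r)]zsignD zsign_sqr mulr1.
Qed.

Lemma jacobi_expand1 M (F : fraction M) :
  jacobi_eventually (fun m n => expand (@iota_xy R) [:: F] (- m - 1) (- n - 1))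
                    (fun m n => expand (@iota_yx R) [:: F] (- m - 1) (- n - 1))
                    (fun m n => expand (@iota_xz R) [:: F] (- m - 1) (- n - 1)).
Proof.
(* Every term of the three sums has total exponent - n - m - l - 2, so all of them see the same
   antidiagonal [N] of the numerator. After exchanging sums, each numerator coefficient is
   multiplied by an instance of [jacobi_weights]. *)
move=> l m n; pose N := - n - m - l - 2 + degree F.
pose K := `|N|%N.+1; pose q := (den_y F)%:Z; pose r := - (den_xy F)%:Z.
exists (`|l| + `|m| + K + den_y F + den_xy F + 2)%N => B BB.
pose f k := num_int (num F) (N - k%:Z) k.
have exp1 iota w s t : has_weight iota w -> s + t + degree F = N ->
    expand iota [:: F] s t = \sum_(k < K) w (k%:Z - q) r t *: f k.
  by move=> wP sN; rewrite (@expand1 _ _ _ _ _ _ K wP) sN//; lia.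
have sumE (c : nat -> R[i]) (w : int -> int -> int -> R[i]) (t : nat -> int) :
    \sum_(i < B) c i *: (\sum_(k < K) w (k%:Z - q) r (t i) *: f k) =
    \sum_(k < K) (\sum_(i < B) c i * w (k%:Z - q) r (t i)) *: f k.
  under eq_bigr do rewrite scaler_sumr; rewrite exchange_big /=.
  by apply: eq_bigr => k _; rewrite scaler_suml; apply: eq_bigr => i _; rewrite scalerA.
have termE (c : nat -> R[i]) iota w (s t : nat -> int) : has_weight iota w ->
    (forall i, s i + t i + degree F = N) ->
    \sum_(i < B) c i *: expand iota [:: F] (s i) (t i) =
    \sum_(k < K) (\sum_(i < B) c i * w (k%:Z - q) r (t i)) *: f k.
  move=> wP st; rewrite -(sumE c w t); apply: eq_bigr => i _.
  by rewrite (exp1 _ _ _ _ wP (st i)).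
have /= EQ := termE (fun i => (-1) ^+ i * binz R l i) _ _
  (fun i => - (n + i%:Z) - 1) (fun i => - (m + l - i%:Z) - 1) iota_yx_weight.
have /= EP := termE (fun i => (-1) ^ l * (-1) ^+ i * binz R l i) _ _
  (fun i => - (n + l - i%:Z) - 1) (fun i => - (m + i%:Z) - 1) iota_xy_weight.
have /= ES := termE (fun i => binz R m i) _ _
  (fun i => - (n + m - i%:Z) - 1) (fun i => - (l + i%:Z) - 1) iota_xz_weight.
rewrite /jacobi_sum EQ ?EP ?ES; [|by move=> i; rewrite /N; lia..].
rewrite -!sumrB big1// => k _; rewrite -!scalerBl jacobi_weights ?scale0r//.
- have := ltn_ord k; rewrite /K /q /r; lia.
- have := ltn_ord k; rewrite /K /q /r; lia.
- have := ltn_ord k; rewrite /K /q /r; lia.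
Qed.

Lemma jacobi_expand M (G : localized M) :
  jacobi_eventually (fun m n => expand (@iota_xy R) G (- m - 1) (- n - 1))
                    (fun m n => expand (@iota_yx R) G (- m - 1) (- n - 1))
                    (fun m n => expand (@iota_xz R) G (- m - 1) (- n - 1)).
Proof.
elim: G => [|F G IH] l m n.
  exists 0%N => B _; rewrite /jacobi_sum /expand.
  by rewrite !big1 ?subr0// => i _; rewrite big_nil scaler0.
have [B0 JB] := jacobi_eventually_lin 1 (@jacobi_expand1 M F) IH l m n.
exists B0 => B /JB <-; apply: eq_jacobi_sum => i j.
- by rewrite expand_cons scale1r.
- by rewrite expand_cons scale1r.
- by rewrite expand_cons scale1r.
Qed.

End Expansions.

(** * Reconstruction of a localized element from the Jacobi identity *)

Section Reconstruction.
Context {R : realType} {M : lmodType R[i]}.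
Implicit Types (P Q S : int -> int -> M) (G : int -> M).

(** A sum over a window containing the support equals the sum over all integers; windows with
    different origins or orientations are compared through the latter. *)
Lemma sum_window G (c : int) (B : nat) :
  (forall k, k < c \/ c + B%:Z <= k -> G k = 0) ->
  \sum_(i < B) G (c + i%:Z) = \sum_(k \in [set: int]) G k.
Proof.
move=> G0; rewrite (@fsbig_ord _ _ _ B (fun i : nat => G (c + i%:Z))).
rewrite -(@fsbig_image _ _ _ _ _ _ (fun i : nat => c + i%:Z) G); last first.
  by move=> i j _ _ /= E; lia.
apply: fsbig_widen => // k [_ /= kB]; apply: G0.
have [|ck] := ltP k c; [by left|right]; rewrite leNgt; apply/negP => kcB.
by apply: kB; exists `|k - c|%N => /=; lia.
Qed.

Lemma sum_shift G (c : int) (K B : nat) :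
  (forall k, k < 0 \/ K%:Z <= k -> G k = 0) ->
  (forall k, k < c \/ c + B%:Z <= k -> G k = 0) ->
  \sum_(k < K) G k%:Z = \sum_(i < B) G (c + i%:Z).
Proof.
move=> GK GB; rewrite (sum_window GB) -(@sum_window _ 0 K).
  by apply: eq_bigr => i _; rewrite add0r.
by move=> k; rewrite add0r; apply: GK.
Qed.

Lemma sum_reflect G (c : int) (K B : nat) :
  (forall k, k < 0 \/ K%:Z <= k -> G k = 0) ->
  (forall k, c < k \/ k <= c - B%:Z -> G k = 0) ->
  \sum_(k < K) G k%:Z = \sum_(i < B) G (c - i%:Z).
Proof.
move=> GK GB; transitivity (\sum_(k \in [set: int]) G k).
  rewrite -(@sum_window _ 0 K); first by apply: eq_bigr => i _; rewrite add0r.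
  by move=> k; rewrite add0r; apply: GK.
rewrite (@reindex_fsbigT _ _ _ _ _ (fun k : int => c - k)); last first.
  by exists (fun k => c - k) => k; lia.
rewrite -(@sum_window _ 0 B) => [|k kB]; last by apply: GB; lia.
by apply: eq_bigr => i _; rewrite add0r.
Qed.

Lemma binz_small (r i : nat) : (r < i)%N -> binz R r i = 0.
Proof.
move=> ri; have := @zbin_sym R r i; rewrite [LHS]/= => ->.
by rewrite zbin_lt0//; lia.
Qed.

(** The coefficients of (1 - z)^a. *)
Definition altbin (a : int) (i : nat) : R[i] := (-1) ^+ i * binz R a i.

(** This is (1 - z)^a (1 - z)^b = (1 - z)^(a+b), with z acting on the finitely supported sequence
    [g] by a shift of the index. *)
Lemma altbin_convolution (a b : int) (g : nat -> M) (B : nat) :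
  (forall i, (B <= i)%N -> g i = 0) ->
  \sum_(i < B) altbin a i *: (\sum_(j < B) altbin b j *: g (i + j)%N) =
  \sum_(i < B) altbin (a + b) i *: g i.
Proof.
move=> g0.
have shift (i : nat) (F : nat -> M) : (forall j, (B <= j)%N -> F j = 0) ->
    \sum_(j < B) F (i + j)%N = \sum_(n < B | (i <= n)%N) F n.
  move=> F0; rewrite -(big_mkord (fun n => (i <= n)%N)) -(big_mkord xpredT (fun j => F (i + j)%N)).
  rewrite -(@big_nat_widenl _ _ _ i 0 B xpredT)//.
  have := @big_addn _ 0 +%R 0%N B i xpredT F; rewrite add0n => ->.
  rewrite (@big_cat_nat _ _ _ (B - i)%N) ?leq_subr//= [X in _ + X]big_nat_cond.
  rewrite [X in _ + X]big1 ?addr0 => [|j /andP[/andP[Bij _] _]]; last by rewrite F0//; lia.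
  by apply: eq_bigr => j _; rewrite addnC.
transitivity (\sum_(i < B) \sum_(n < B | (i <= n)%N) (altbin a i * altbin b (n - i)) *: g n).
  apply: eq_bigr => i _; rewrite scaler_sumr.
  rewrite -(@shift i (fun n => (altbin a i * altbin b (n - i)) *: g n)).
    by apply: eq_bigr => j _; rewrite scalerA addKn.
  by move=> j /g0 ->; rewrite scaler0.
rewrite (exchange_big_dep xpredT)//=; apply: eq_bigr => n _.
rewrite -scaler_suml; congr (_ *: _).
have := @vandermonde R a b n B; rewrite ltz_nat ltn_ord => /(_ isT) /= E.
rewrite /altbin -E mulr_sumr [RHS](bigID (fun i : 'I_B => (i <= n)%N)) /=.
rewrite [X in _ = _ + X]big1 ?addr0 => [|i]; last first.
  by rewrite -ltnNge => ni; rewrite zbin_lt0 ?mulr0//; lia.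
apply: eq_bigr => i iN; rewrite (_ : n%:Z - i%:Z = (n - i)%N) /=; last by lia.
by rewrite -{3}(subnK iN) exprD; ring.
Qed.

Lemma altbin_inverse (a : int) (g : nat -> M) (B : nat) :
  (forall i, (B <= i)%N -> g i = 0) ->
  \sum_(i < B) altbin (- a) i *: (\sum_(j < B) altbin a j *: g (i + j)%N) = g 0%N.
Proof.
move=> g0; rewrite altbin_convolution// addNr.
case: B g0 => [g0|B _]; first by rewrite big_ord0 g0.
rewrite big_ord_recl big1 ?addr0 => [|i _]; last first.
  by rewrite /altbin binz0 mulr0 scale0r.
by rewrite /altbin binz0 mulr1 scale1r.
Qed.

(** The second hypothesis makes [num] the numerator x^p y^q (x-y)^r P. Since the powers of y in P
    are bounded below, it may be multiplied by (x-y)^(-r) expanded in powers of y, which returns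
    P. *)
Lemma expand_iota_xyK P (p q r : nat) (num : nat -> nat -> M) :
  (forall m n, q%:Z <= n -> P m n = 0) ->
  (forall (j : int) (k : nat) (B : nat), (r < B)%N -> num_int num j k =
     \sum_(i < B) altbin r i *: P (p%:Z + r%:Z - j - i%:Z - 1) (q%:Z - k%:Z + i%:Z - 1)) ->
  forall m n, expand (@iota_xy R) [:: Fraction num p q r] (- m - 1) (- n - 1) = P m n.
Proof.
move=> Pq numE m n; pose s := - m - 1; pose t := - n - 1.
pose D : int := p%:Z + q%:Z + r%:Z.
pose B := (`|s| + `|t| + p + q + r + 1)%N.
pose h (j k : int) := \sum_(i < B) altbin r i *:
  P (p%:Z + r%:Z - j - i%:Z - 1) (q%:Z - k + i%:Z - 1).
have h0 j k : k < 0 -> h j k = 0.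
  by move=> k0; rewrite /h big1// => i _; rewrite Pq ?scaler0//; lia.
rewrite (@expand1 _ _ _ _ _ _ _ B iota_xy_weight) /degree /= -/s -/t; last by lia.
pose G (k : int) := weight_xy (k - q%:Z) (- r%:Z) t *: h (s + t + D - k) k : M.
transitivity (\sum_(k < B) G k%:Z).
  by apply: eq_bigr => k _; rewrite (numE _ _ B)//; lia.
have G0 k : k < 0 \/ t + q%:Z < k -> G k = 0.
  case=> k0; rewrite /G; first by rewrite h0 ?scaler0.
  by rewrite /weight_xy zbin_lt0 ?mulr0 ?scale0r//; lia.
rewrite (@sum_reflect G (t + q%:Z) B B); [|by move=> k kB; apply: G0; lia..].
(* With z moving (m, n) to (m - 1, n + 1), the expansion becomes (1 - z)^(-r) (1 - z)^r applied to
   [g]. *)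
pose g (i : nat) := P (m - i%:Z) (n + i%:Z).
transitivity (\sum_(i < B) altbin (- r%:Z) i *:
   (\sum_(j < B) altbin r j *: g (i + j)%N)); last first.
  rewrite altbin_inverse /g ?subr0 ?addr0// => i Bi; apply: Pq; lia.
apply: eq_bigr => i _; rewrite /G /weight_xy.
rewrite (_ : t - _ = i%:Z) ?zsign_nat; last by lia.
congr (_ *: _); apply: eq_bigr => j _; rewrite /g; congr (_ *: P _ _); lia.
Qed.

(** The mirror image of the previous argument; the sign comes from (x-y)^r = (-1)^r (y-x)^r. Nothing
    bounds the powers of y in Q from below, so the last hypothesis asks that x^p y^q (x-y)^r Q have
    no negative powers of y. *)
Lemma expand_iota_yxK Q (p q r : nat) (num : nat -> nat -> M) :
  (forall m n, p%:Z <= m -> Q m n = 0) ->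
  (forall (j : int) (k : nat) (B : nat), (r < B)%N -> num_int num j k =
     (-1) ^+ r *: \sum_(i < B) altbin r i *:
        Q (p%:Z - j - 1 + i%:Z) (q%:Z - k%:Z - 1 + r%:Z - i%:Z)) ->
  (forall j (k : int) (B : nat), k < 0 -> (r < B)%N -> \sum_(i < B) altbin r i *:
        Q (p%:Z - j - 1 + i%:Z) (q%:Z - k - 1 + r%:Z - i%:Z) = 0) ->
  forall m n, expand (@iota_yx R) [:: Fraction num p q r] (- m - 1) (- n - 1) = Q m n.
Proof.
move=> Qp numE Qk m n; pose s := - m - 1; pose t := - n - 1.
pose D : int := p%:Z + q%:Z + r%:Z.
pose B := (`|s| + `|t| + p + q + r + 1)%N.
pose h (j k : int) := (-1) ^+ r *: \sum_(i < B) altbin r i *: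
  Q (p%:Z - j - 1 + i%:Z) (q%:Z - k - 1 + r%:Z - i%:Z).
have h0 j k : j < 0 \/ k < 0 -> h j k = 0.
  case=> jk0; rewrite /h; last by rewrite Qk ?scaler0//; lia.
  by rewrite big1 ?scaler0// => i _; rewrite Qp ?scaler0//; lia.
rewrite (@expand1 _ _ _ _ _ _ _ B iota_yx_weight) /degree /= -/s -/t; last by lia.
pose G (k : int) := weight_yx (k - q%:Z) (- r%:Z) t *: h (s + t + D - k) k : M.
transitivity (\sum_(k < B) G k%:Z).
  by apply: eq_bigr => k _; rewrite (numE _ _ B)//; lia.
have G0 k : k < 0 \/ k < q%:Z + r%:Z + t \/ s + t + D < k -> G k = 0.
  case=> [k0|[k0|k0]]; rewrite /G.
  - by rewrite h0 ?scaler0//; right.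
  - by rewrite /weight_yx zbin_lt0 ?mulr0 ?scale0r//; lia.
  - by rewrite h0 ?scaler0//; left; lia.
rewrite (@sum_shift G (q%:Z + r%:Z + t) B B); [|by move=> k kB; apply: G0; lia..].
pose g (i : nat) := Q (m + i%:Z) (n - i%:Z).
transitivity (\sum_(i < B) altbin (- r%:Z) i *:
   (\sum_(j < B) altbin r j *: g (i + j)%N)); last first.
  rewrite altbin_inverse /g ?subr0 ?addr0// => i Bi; apply: Qp; lia.
apply: eq_bigr => i _; rewrite /G /weight_yx.
rewrite (_ : _ - t = i%:Z) /=; last by lia.
rewrite (_ : t - _ = - (r%:Z + i%:Z)) ?zsignN ?zsignD ?zsign_nat; last by lia.
have -> : s + t + D - (q%:Z + r%:Z + t + i%:Z) = p%:Z + s - i%:Z by rewrite /D; lia.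
rewrite scalerA (_ : _ * _ * _ * _ = ((-1) ^+ r) ^+ 2 * altbin (- r%:Z) i); last first.
  by rewrite /altbin; ring.
rewrite sqrr_sign mul1r; congr (_ *: _).
apply: eq_bigr => j _; rewrite /g; congr (_ *: Q _ _); lia.
Qed.

(** The truncation bounds become pole orders: [q] in y from P, [p] in x from Q, [r] in x - y from S.
    The common value x^p y^q (x-y)^r P = x^p y^q (x-y)^r Q has no negative powers of y because of P
    and none of x because of Q, so it is a numerator. *)
Lemma jacobi_localized P Q S :
  (exists N : int, forall m n, N <= n -> P m n = 0) ->
  (exists N : int, forall m n, N <= m -> Q m n = 0) ->
  (exists N : int, forall m n, N <= n -> S m n = 0) ->
  jacobi_eventually P Q S ->
  exists G : localized M, forall m n,
    [/\ expand (@iota_xy R) G (- m - 1) (- n - 1) = P m n,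
        expand (@iota_yx R) G (- m - 1) (- n - 1) = Q m n &
        expand (@iota_xz R) G (- m - 1) (- n - 1) = S m n].
Proof.
have bound (T : int -> Prop) : (forall m n, m <= n -> T m -> T n) ->
    (exists N, T N) -> exists N : nat, T N%:Z.
  by move=> Tle [N TN]; exists `|N|%N; apply: Tle TN; lia.
move=> /bound[m n mn H i j ni|q Pq]; first by apply: H; lia.
move=> /bound[m n mn H i j ni|p Qp]; first by apply: H; lia.
move=> /bound[m n mn H i j ni|r Sr]; first by apply: H; lia.
move=> J.
pose h (j k : int) (B : nat) := \sum_(i < B) altbin r i *:
  P (p%:Z + r%:Z - j - i%:Z - 1) (q%:Z - k + i%:Z - 1).
pose h' (j k : int) (B : nat) := \sum_(i < B) altbin r i *:
  Q (p%:Z - j - 1 + i%:Z) (q%:Z - k - 1 + r%:Z - i%:Z).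
have stable (F : nat -> M) B B' : (r < B)%N -> (r < B')%N ->
    \sum_(i < B) altbin r i *: F i = \sum_(i < B') altbin r i *: F i.
  wlog BB' : B B' / (B <= B')%N.
    by move=> H rB rB'; have [/H->//|/ltnW/H->//] := leqP B B'.
  move=> rB _; rewrite -!(big_mkord xpredT (fun i => altbin r i *: F i)).
  rewrite [RHS](@big_cat_nat _ _ _ B)//= [X in _ = _ + X]big_nat_cond.
  rewrite [X in _ = _ + X]big1 ?addr0// => i /andP[/andP[Bi _] _].
  by rewrite /altbin binz_small ?mulr0 ?scale0r//; lia.
(* Weak commutativity: at l = r only modes S _ (r + i) occur, and they all vanish. *)
have hh' j k B : (r < B)%N -> h j k B = (-1) ^+ r *: h' j k B.
  move=> rB; have [B0 /(_ (maxn B0 B) (leq_maxl _ _))] := J r (q%:Z - k - 1) (p%:Z - j - 1).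
  rewrite /jacobi_sum [X in _ - X]big1 ?subr0 => [|i _]; last by rewrite Sr ?scaler0//; lia.
  have rm : (r < maxn B0 B)%N by rewrite leq_max rB orbT.
  have -> : h' j k B = h' j k (maxn B0 B).
    exact: (stable (fun i => Q (p%:Z - j - 1 + i%:Z) (q%:Z - k - 1 + r%:Z - i%:Z))).
  have -> : h j k B = h j k (maxn B0 B).
    exact: (stable (fun i => P (p%:Z + r%:Z - j - i%:Z - 1) (q%:Z - k + i%:Z - 1))).
  rewrite /h' => /eqP; rewrite subr_eq0 => /eqP ->.
  rewrite /h scaler_sumr; apply: eq_bigr => i _.
  rewrite scalerA (_ : _ * _ = ((-1) ^+ r) ^+ 2 * altbin r i); last first.
    by rewrite /altbin -exprnP; ring.
  by rewrite sqrr_sign mul1r; congr (_ *: P _ _); lia.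
pose num (j k : nat) := h j k r.+1.
(* For negative j the value is computed on the side of Q, all of whose modes involved have first
   index at least p. *)
have numE (j : int) (k : nat) (B : nat) : (r < B)%N -> num_int num j k = h j k B.
  move=> rB; case: j => j; first exact:
    (stable (fun i => P (p%:Z + r%:Z - j%:Z - i%:Z - 1) (q%:Z - k%:Z + i%:Z - 1))).
  rewrite hh'// /h' big1 ?scaler0// => i _; rewrite Qp ?scaler0//; lia.
pose G := [:: Fraction num p q r].
have GP m n : expand (@iota_xy R) G (- m - 1) (- n - 1) = P m n.
  exact: expand_iota_xyK.
have GQ m n : expand (@iota_yx R) G (- m - 1) (- n - 1) = Q m n.
  apply: expand_iota_yxK => //.
    by move=> j k B rB; rewrite (numE _ _ _ rB) hh'.
  move=> j k B k0 rB; have : (-1) ^+ r *: h' j k B = 0.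
    by rewrite -hh'// /h big1// => i _; rewrite Pq ?scaler0//; lia.
  by move=> /eqP; rewrite scaler_eq0 signr_eq0 => /eqP.
exists G => m n; split=> //.
(* The difference between the expansions of [G] and the given triple satisfies the Jacobi identity
   and has zero first two components. At middle index 0 the third sum reduces to its term i = 0, so
   that component vanishes too. *)
have := jacobi_eventually_lin (-1) (@jacobi_expand R M G) J => /(_ n 0 m)[B0].
move=> /(_ B0.+1 (leqnSn _)); rewrite /jacobi_sum.
rewrite big1 => [|i _]; last by rewrite GQ scaleN1r addNr scaler0.
rewrite big1 => [|i _]; last by rewrite GP scaleN1r addNr scaler0.
rewrite big_ord_recl big1 => [|i _]; last by rewrite binz0 scale0r.
rewrite binz0 scale1r !addr0 !subr0 sub0r => /eqP.
by rewrite oppr_eq0 scaleN1r addrC subr_eq0 => /eqP.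
Qed.

End Reconstruction.

(** * Infinite and truncated forms of the Jacobi identity *)

Section JacobiTruncation.
Context {R : realType}.

Lemma jacobi_sum_limit (M : lmodType R[i]) (P Q S : int -> int -> M) (l m n : int) :
  (exists N : int, forall i j, N <= j -> P i j = 0) ->
  (exists N : int, forall i j, N <= i -> Q i j = 0) ->
  (exists N : int, forall i j, N <= j -> S i j = 0) ->
  exists B0 : nat, forall B, (B0 <= B)%N -> jacobi_sum P Q S l m n B =
    \sum_(i \in [set: nat]) ((-1) ^+ i * binz R l i) *: Q (n + i%:Z) (m + l - i%:Z)
    - \sum_(i \in [set: nat])
        ((-1) ^ l * (-1) ^+ i * binz R l i) *: P (n + l - i%:Z) (m + i%:Z)
    - \sum_(i \in [set: nat]) binz R m i *: S (n + m - i%:Z) (l + i%:Z).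
Proof.
move=> [NP P0] [NQ Q0] [NS S0].
exists (`|NP - m| + `|NQ - n| + `|NS - l|)%N => B BB; rewrite /jacobi_sum.
congr (_ - _ - _); symmetry; apply: fsum_widen => i iB.
- by rewrite Q0 ?scaler0//; lia.
- by rewrite P0 ?scaler0//; lia.
- by rewrite S0 ?scaler0//; lia.
Qed.

Lemma jacobi_eventuallyP (W1 W2 W3 : lmodType R[i]) (Y1 : W1 -> int -> W1)
    (Y2 : W2 -> int -> W2) (Y3 : W3 -> int -> W3) (I : W1 -> W2 -> int -> W3) :
  bilin I -> (forall n, Y3 0 n = 0) -> (forall u v, in_laurent (I u v)) ->
  (forall u, in_laurent (Y1 u)) -> (forall v, in_laurent (Y2 v)) ->
  jacobi Y1 Y2 Y3 I <->
  forall u v, jacobi_eventually (fun i j => I u (Y2 v j) i) (fun i j => Y3 (I u v i) j)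
                                (fun i j => I (Y1 u j) v i).
Proof.
move=> bI Y30 It Y1t Y2t; have [I0 I0'] := bilin0 bI.
have lim u v l m n := @jacobi_sum_limit _ (fun i j => I u (Y2 v j) i)
  (fun i j => Y3 (I u v i) j) (fun i j => I (Y1 u j) v i) l m n.
have {}lim u v l m n := lim u v l m n
  (let: ex_intro N H := Y2t v in
   ex_intro _ N (fun i j Nj => etrans (congr1 (I u ^~ i) (H j Nj)) (I0' u i)))
  (let: ex_intro N H := It u v in
   ex_intro _ N (fun i j Nj => etrans (congr1 (Y3 ^~ j) (H i Nj)) (Y30 j)))
  (let: ex_intro N H := Y1t u in
   ex_intro _ N (fun i j Nj => etrans (congr1 (fun w => I w v i) (H j Nj)) (I0 v i))).
split=> [J u v l m n|J u v l m n].
  have [B0 BE] := lim u v l m n; exists B0 => B /BE ->.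
  apply/eqP; rewrite subr_eq0; apply/eqP; have := J u v l m n.
  under [X in X - _ = _ -> _]eq_fsbigr do rewrite natz.
  under [X in _ - X = _ -> _]eq_fsbigr do rewrite natz intz.
  by under [X in _ = X -> _]eq_fsbigr do rewrite natz intz.
have [B0 BE] := lim u v l m n; have [B1 BJ] := J u v l m n.
have := BE _ (leq_maxl B0 B1); rewrite BJ ?leq_maxr// => /esym/eqP.
rewrite subr_eq0 => /eqP.
under [X in _ -> X - _ = _]eq_fsbigr do rewrite natz.
under [X in _ -> _ - X = _]eq_fsbigr do rewrite natz intz.
by under [X in _ -> _ = X]eq_fsbigr do rewrite natz intz.
Qed.

Lemma jacobi_eventually_map (M M' : lmodType R[i]) (f : {linear M -> M'})
    (P Q S : int -> int -> M) :
  jacobi_eventually P Q S ->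
  jacobi_eventually (fun i j => f (P i j)) (fun i j => f (Q i j)) (fun i j => f (S i j)).
Proof.
move=> J l m n; have [B0 JB] := J l m n; exists B0 => B /JB J0.
transitivity (f (jacobi_sum P Q S l m n B)); last by rewrite J0 linear0.
rewrite /jacobi_sum !linearB !(linear_sum f).
by congr (_ - _ - _); apply: eq_bigr => i _; rewrite linearZ.
Qed.

(** In the identity at l, m, n the two indices of every term add up to n + m + l, so the factor is
    constant throughout. *)
Lemma jacobi_eventually_degree (M : lmodType R[i]) (c : R[i]) (P Q S : int -> int -> M) :
  jacobi_eventually P Q S ->
  jacobi_eventually (fun i j => (c + (i + j)%:~R) *: P i j)
    (fun i j => (c + (i + j)%:~R) *: Q i j) (fun i j => (c + (i + j)%:~R) *: S i j).
Proof.
move=> J l m n; have [B0 JB] := J l m n.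
exists B0 => B /JB J0.
transitivity ((c + (n + m + l)%:~R) *: jacobi_sum P Q S l m n B); last by rewrite J0 scaler0.
rewrite /jacobi_sum !scalerBr !scaler_sumr.
by congr (_ - _ - _); apply: eq_bigr => i _; rewrite !scalerA mulrC;
  congr ((_ + _%:~R) * _ *: _); lia.
Qed.

Lemma eq_jacobi_eventually (M : lmodType R[i]) (P Q S P' Q' S' : int -> int -> M) :
  P =2 P' -> Q =2 Q' -> S =2 S' ->
  jacobi_eventually P Q S -> jacobi_eventually P' Q' S'.
Proof.
move=> PE QE SE J l m n; have [B0 JB] := J l m n; exists B0 => B /JB <-.
by symmetry; apply: eq_jacobi_sum.
Qed.

End JacobiTruncation.

(** * Generalized eigenspaces of L(0) *)

Section GeneralizedEigenspaces.
Context {R : realType} {V : voa R}.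

Definition shiftedL0 (M : wmodule V) (h : R[i]) (w : M) : M := wmod_L 0 w - h *: w.

(** Unlike in [gen_eigenspace], the exponent 0 is allowed; it forces w = 0 and starts the inductions
    on nilpotency order. *)
Definition nilp (M : wmodule V) (h : R[i]) (n : nat) (w : M) : Prop :=
  iter n (shiftedL0 h) w = 0.

Context (M : wmodule V).
Implicit Types (w : M) (h : R[i]).

Lemma wmod_L_linear n : linear (@wmod_L R V M n).
Proof. exact: (wmod_bilin M).2. Qed.

Lemma wmod_LZ n c w : wmod_L n (c *: w) = c *: wmod_L n w.
Proof.
have := wmod_L_linear n c w 0.
by rewrite /wmod_L (bilin0 (wmod_bilin M)).2 !addr0.
Qed.

Lemma nilp0 h n : nilp h n (0 : M).
Proof. exact: iterT0. Qed.

Lemma nilp_widen h m n w : (m <= n)%N -> nilp h m w -> nilp h n w.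
Proof. by move=> /subnK <- wm; rewrite /nilp iterD wm; apply: nilp0. Qed.

Lemma gen_eigenspaceP h w : gen_eigenspace M h w <-> exists n, nilp h n w.
Proof.
split=> [[n [_ wn]]|[n wn]]; first by exists n.
by exists n.+1; split=> //; apply: nilp_widen wn.
Qed.

Lemma nilpS h n w : nilp h n.+1 w <-> nilp h n (shiftedL0 h w).
Proof. by rewrite /nilp iterSr. Qed.

Lemma nilp_shift h h' n w : nilp h n w -> nilp h n (shiftedL0 h' w).
Proof.
rewrite /nilp => wn; have := iterT_comm n h h' w; rewrite -[LHS]/(iter n (shiftedL0 h) _).
by move=> ->; rewrite [iter _ _ _]wn; apply: (nilp0 _ 1).
Qed.

Lemma gen_eigenspace_subspace h : subspace (gen_eigenspace M h).
Proof.
split; first by apply/gen_eigenspaceP; exists 0%N.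
move=> c u v /gen_eigenspaceP[m um] /gen_eigenspaceP[n vn]; apply/gen_eigenspaceP.
exists (maxn m n); have := iterT_lin (maxn m n) h c u v.
rewrite /nilp => ->; rewrite [iter _ _ u](nilp_widen (leq_maxl m n) um).
by rewrite [iter _ _ v](nilp_widen (leq_maxr m n) vn) scaler0 addr0.
Qed.

Lemma gen_eigenspace_L0 h w : gen_eigenspace M h w -> gen_eigenspace M h (wmod_L 0 w).
Proof.
move=> /gen_eigenspaceP[n wn]; apply/gen_eigenspaceP; exists n.
have -> : wmod_L 0 w = shiftedL0 0 w by rewrite /shiftedL0 scale0r subr0.
exact: nilp_shift.
Qed.

Lemma subspaceB (U : lmodType R[i]) (D : set U) x y : subspace D -> D x -> D y -> D (x - y).
Proof. by move=> [_ Dl] Dx Dy; rewrite addrC -scaleN1r; apply: Dl. Qed.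

Lemma subspaceZ (U : lmodType R[i]) (D : set U) c x : subspace D -> D x -> D (c *: x).
Proof. by move=> [D0 Dl] Dx; rewrite -[_ *: _]addr0; apply: Dl. Qed.

Lemma direct_sum_ind (T : choiceType) (U : lmodType R[i]) (D : T -> set U) (P : U -> Prop) :
  direct_sum D -> P 0 -> (forall x y, P x -> P y -> P (x + y)) ->
  (forall i x, D i x -> P x) -> forall x, P x.
Proof.
move=> [_ dec] P0 PD PDi x; have [f [[ff fD ->] _]] := dec x.
rewrite -(@fsbig_widen _ _ _ _ [set i | f i <> 0])//; last first.
  by move=> i [_ /= /contrapT].
by rewrite fsbig_finite//; apply: big_ind => // i _; exact: PDi (fD i).
Qed.

Lemma direct_sum_ind2 (T1 T2 : choiceType) (U1 U2 : lmodType R[i])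
    (D1 : T1 -> set U1) (D2 : T2 -> set U2) (P : U1 -> U2 -> Prop) :
  direct_sum D1 -> direct_sum D2 ->
  (forall v, P 0 v) -> (forall x y v, P x v -> P y v -> P (x + y) v) ->
  (forall u, P u 0) -> (forall u x y, P u x -> P u y -> P u (x + y)) ->
  (forall i j u v, D1 i u -> D2 j v -> P u v) -> forall u v, P u v.
Proof.
move=> dec1 dec2 P0 PD P0' PD' PD12 u v.
apply: (direct_sum_ind dec1 (P := P ^~ v)) => // [x y|i x xi]; first exact: PD.
by apply: (direct_sum_ind dec2) => // [y z|j y]; [apply: PD'|apply: PD12 xi].
Qed.

Lemma gen_eigenspace_extend0 lam (dec : L0_decomposed M lam) (n : int) w :
  extend0 (fun j : nat => gen_eigenspace M (lam + j%:R)) n w <->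
  gen_eigenspace M (lam + n%:~R) w.
Proof.
case: n => [n|n] //=; split=> [->|].
  by have [] := gen_eigenspace_subspace (lam + (Negz n)%:~R).
by apply: (gen_eigenspace0 dec) => j; rewrite (inj_eq (addrI lam)) pmulrn eqr_int.
Qed.

Lemma gen_eigenspace_neg lam (dec : L0_decomposed M lam) (n : int) w : n < 0 ->
  gen_eigenspace M (lam + n%:~R) w -> w = 0.
Proof. by case: n => // n _ /(gen_eigenspace_extend0 dec). Qed.

Lemma gen_eigenspace_nonint lam (dec : L0_decomposed M lam) h w :
  (forall n : int, h <> lam + n%:~R) -> gen_eigenspace M h w -> w = 0.
Proof. by move=> hn; apply: (gen_eigenspace0 dec) => j; apply/eqP; rewrite pmulrn. Qed.

End GeneralizedEigenspaces.

(** * The commutator with L(0) *)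

Section OmegaJacobi.
Context {R : realType} {V : voa R} (W1 W2 W3 : wmodule V).

(* The coefficient of [L(0), I(u,x)] = x I(L(-1)u,x) + I(L(0)u,x). *)
Lemma jacobi_L0 (A : pzRingType) (I : W1 -> W2 -> A -> W3) u v al :
  (forall u n, I u 0 n = 0) ->
  jacobi (wmod_Y (omega V)) (wmod_Y (omega V)) (wmod_Y (omega V)) I ->
  wmod_L 0 (I u v al) - I u (wmod_L 0 v) al =
  I (wmod_L (-1) u) v (al + 1) + I (wmod_L 0 u) v al.
Proof.
move=> I0 /(_ u v 0 1 al).
have Y0 n : wmod_Y (omega V) (0 : W3) n = 0 by rewrite (bilin0 (wmod_bilin W3)).2.
rewrite [X in X - _ = _ -> _](@fsum_single _ _ _ 0%N); last first.
  by move=> i /eqP/negbTE i0; rewrite binz0 i0 mulr0 scale0r.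
rewrite [X in _ - X = _ -> _](@fsum_single _ _ _ 0%N); last first.
  by move=> i /eqP/negbTE i0; rewrite binz0 i0 mulr0 scale0r.
rewrite [X in _ = X -> _](@fsum_widen _ _ _ 2); last first.
  by move=> i i2; rewrite binz1 leqNgt i2 scale0r.
rewrite 2!big_ord_recl big_ord0 !binz0 !binz1 eqxx /= /bump /=.
rewrite !expr0 expr0z !mul1r !scale1r !addr0 ?subr0.
by rewrite /wmod_L !add0r addn0 addrK.
Qed.

End OmegaJacobi.

(** * Weights of the coefficients of a logarithmic operator *)

Section LogarithmicSide.
Context {R : realType} {V : voa R} (W1 W2 W3 : wmodule V).

Lemma gen_eigenspace_shift_inv (M : wmodule V) h (w : M) :
  gen_eigenspace M h (shiftedL0 h w) -> gen_eigenspace M h w.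
Proof. by move=> /gen_eigenspaceP[n /nilpS wn]; apply/gen_eigenspaceP; exists n.+1. Qed.

Lemma bilinB (A : Type) (U1 U2 U3 : lmodType R[i]) (I : U1 -> U2 -> A -> U3) :
  bilin I ->
  (forall c u u' v n, I (u - c *: u') v n = I u v n - c *: I u' v n) /\
  (forall c u v v' n, I u (v - c *: v') n = I u v n - c *: I u v' n).
Proof.
move=> /bilinD[Dl Dr]; split=> [c u u' v n|c u v v' n].
  by rewrite [u - _]addrC -(scaleNr c u') Dl scaleNr addrC.
by rewrite [v - _]addrC -(scaleNr c v') Dr scaleNr addrC.
Qed.

(** A formal identity for any e. For e = al + 1 the last bracket is the next logarithmic
    coefficient, by [log_succ]; for e = n + lam + 1 it is [delta]. *)
Lemma shiftedL0_bilin (A : Type) (I : W1 -> W2 -> A -> W3) (h1 h2 e : R[i]) u v n :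
  bilin I ->
  shiftedL0 (h1 + h2 - e) (I u v n) =
  I (shiftedL0 h1 u) v n + I u (shiftedL0 h2 v) n +
  (wmod_L 0 (I u v n) - I u (wmod_L 0 v) n - I (wmod_L 0 u) v n + e *: I u v n).
Proof.
move=> /bilinB[Bl Br]; rewrite /shiftedL0 Bl Br scalerBl scalerDl.
set x := wmod_L 0 (I u v n); set y := I u (wmod_L 0 v) n; set z := I (wmod_L 0 u) v n.
set a := h1 *: _; set b := h2 *: _; set c := e *: _.
rewrite [z - a + _]addrACA -[x - y - z]addrA -(opprD y z) [y + z]addrC -(opprD a b).
rewrite [z + y - (a + b)]addrC -[RHS]addrA [x - (z + y) + c]addrAC.
by rewrite [z + y + _]addrC subrK opprB [LHS]addrA [LHS]addrC.
Qed.

Context (I : W1 -> W2 -> R[i] -> nat -> W3).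
Context (logI : is_log_intertwining I).

(** The L(-1)-derivative property turns the term x I(L(-1)u,x) of the L(0) commutator into x d/dx
    I(u,x), and differentiating (log x)^(k+1) brings in the coefficient of index k + 1. *)
Lemma log_succ u v al k :
  k.+1%:R *: I u v al k.+1 =
  wmod_L 0 (I u v al k) - I u (wmod_L 0 v) al k - I (wmod_L 0 u) v al k
  + (al + 1) *: I u v al k.
Proof.
have [bI _ _ jI dI] := logI.
have I0 u' n : I u' 0 n k = 0 by rewrite (bilin0 (bI k)).2.
have -> := jacobi_L0 u v al I0 (jI _ k).
rewrite (dI u v) /log_derivative !addrK scaleNr; set x := _ *: I u v al k.
by rewrite [- _ + _]addrC subrK.
Qed.

(** Applying L(0) - h to the coefficient gives three terms: one with u replaced by (L(0) - h1)u, one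
    with v replaced by (L(0) - h2)v, and a multiple of the next logarithmic coefficient. The first
    two are covered by induction on the sum of nilpotency orders, the third by descending induction
    on [k] from the point where the coefficients vanish. *)
Lemma log_gen_eigenspace h1 h2 u v al k :
  gen_eigenspace W1 h1 u -> gen_eigenspace W2 h2 v ->
  gen_eigenspace W3 (h1 + h2 - (al + 1)) (I u v al k).
Proof.
have [bI fI _ _ _] := logI.
move=> /gen_eigenspaceP[a ua] /gen_eigenspaceP[b vb].
have [S0 Sl] := gen_eigenspace_subspace W3 (h1 + h2 - (al + 1)).
have SD x y : gen_eigenspace W3 (h1 + h2 - (al + 1)) x ->
    gen_eigenspace W3 (h1 + h2 - (al + 1)) y ->
    gen_eigenspace W3 (h1 + h2 - (al + 1)) (x + y).
  by move=> Sx Sy; rewrite -[x]scale1r; apply: Sl.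
have [N abN] : exists N, (a + b <= N)%N by exists (a + b)%N.
elim: N => [|N IH] in a b u v k ua vb abN *.
  have a0 : a = 0%N by lia.
  by rewrite (_ : u = 0) ?(bilin0 (bI k)).1//; rewrite a0 in ua.
case: a => [|a] in ua abN *; first by rewrite (_ : u = 0) ?(bilin0 (bI k)).1.
case: b => [|b] in vb abN *; first by rewrite (_ : v = 0) ?(bilin0 (bI k)).2.
have [K IK] := fI u v al.
have [d Kd] : exists d, (K <= k + d)%N by exists K; rewrite leq_addl.
elim: d => [|d IHd] in k Kd *; first by rewrite IK//; lia.
apply: gen_eigenspace_shift_inv.
rewrite (shiftedL0_bilin _ _ _ _ _ _ (bI k)) -log_succ.
apply: (SD); last by rewrite -[_ *: _]addr0; apply: Sl => //; apply: IHd; lia.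
apply: SD; apply: IH.
- by move/nilpS: ua; apply.
- exact: vb.
- lia.
- exact: ua.
- by move/nilpS: vb; apply.
- lia.
Qed.

End LogarithmicSide.

(** * The operator delta preserves the Jacobi identity *)

Section Delta.
Context {R : realType} {V : voa R} (W1 W2 W3 : wmodule V) (lam : R[i]).
Implicit Types (Phi : W1 -> W2 -> int -> W3).

(* In terms of the logarithmic operator, delta maps the coefficient of (log x)^k
   to (k+1) times that of (log x)^(k+1). *)
Definition delta Phi : W1 -> W2 -> int -> W3 := fun u v n =>
  wmod_L 0 (Phi u v n) - Phi u (wmod_L 0 v) n - Phi (wmod_L 0 u) v n
  + (n%:~R + lam + 1) *: Phi u v n.

(** The nested form c *: x + y is the one to which [bilin_lin] and [jacobi_eventually_lin] apply. *)
Lemma deltaE Phi u v n : delta Phi u v n =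
  1 *: wmod_L 0 (Phi u v n) + ((-1) *: Phi u (wmod_L 0 v) n +
  ((-1) *: Phi (wmod_L 0 u) v n + (n%:~R + lam + 1) *: Phi u v n)).
Proof. by rewrite /delta scale1r !scaleN1r !addrA. Qed.

Lemma bilin_scale (A : Type) (U1 U2 U3 : lmodType R[i]) (c : A -> R[i])
  (I : U1 -> U2 -> A -> U3) : bilin I -> bilin (fun u v n => c n *: I u v n).
Proof.
by move=> /bilinD[Dl Dr]; split=> [v n|u n] d x y /=; rewrite (Dl, Dr) scalerDr !scalerA mulrC.
Qed.

Lemma delta_bilin Phi : bilin Phi -> bilin (delta Phi).
Proof.
move=> bPhi; have [Dl Dr] := bilinD bPhi.
have b1 : bilin (fun u v n => wmod_L 0 (Phi u v n)).
  by split=> [v n|u n] d x y /=; rewrite ?Dl ?Dr wmod_L_linear.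
have b2 : bilin (fun u v n => Phi u (wmod_L 0 v) n).
  by split=> [v n|u n] d x y /=; rewrite ?wmod_L_linear ?Dl ?Dr.
have b3 : bilin (fun u v n => Phi (wmod_L 0 u) v n).
  by split=> [v n|u n] d x y /=; rewrite ?wmod_L_linear ?Dl ?Dr.
have b4 := bilin_scale (fun n : int => n%:~R + lam + 1) bPhi.
have := bilin_lin 1 b1 (bilin_lin (-1) b2 (bilin_lin (-1) b3 b4)).
by congr bilin; do 3!(apply/funext => ?); rewrite deltaE.
Qed.

Definition jacobi_modes Phi (a : V) := forall u v,
  jacobi_eventually (fun i j => Phi u (wmod_Y a v j) i)
    (fun i j => wmod_Y a (Phi u v i) j) (fun i j => Phi (wmod_Y a u j) v i).

Lemma jacobi_modes_delta_homogeneous Phi (p : int) (a : V) : bilin Phi ->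
  wt_space p a -> jacobi_modes Phi a -> jacobi_modes (delta Phi) a.
Proof.
move=> bPhi pa J u v; have [Dl Dr] := bilinD bPhi.
pose L0 : {linear W3 -> W3} := HB.pack (@wmod_L R V W3 0)
  (GRing.isLinear.Build _ _ _ _ _ (wmod_L_linear (M := W3) 0)).
(* Moving L(0) past the mode a_j costs p - j - 1. Together with the factor i + lam + 1 from [delta]
   this leaves lam + 2 - p + (i + j), the same in all three products. *)
have jd := jacobi_eventually_degree (lam + 2 - p%:~R) (J u v).
have := jacobi_eventually_lin (-1) (J (wmod_L 0 u) v) jd.
move=> /(jacobi_eventually_lin (-1) (J u (wmod_L 0 v))).
move=> /(jacobi_eventually_lin 1 (jacobi_eventually_map L0 (J u v))).
have comm (M : wmodule V) (w : M) k : wmod_L 0 (wmod_Y a w k) =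
    (p - k - 1)%:~R *: wmod_Y a w k + wmod_Y a (wmod_L 0 w) k.
  by rewrite -(L0_comm k w pa) subrK.
apply: eq_jacobi_eventually => i j /=.
- rewrite deltaE; congr (_ + _); rewrite comm Dr scalerDr -[RHS]addrA [RHS]addrCA.
  congr (_ + _); rewrite [RHS]addrCA scalerA -scalerDl; congr (_ + _ *: _).
  by rewrite !rmorphB rmorphD /=; ring.
- have YZ c x : wmod_Y a (c *: x) j = c *: wmod_Y a x j :> W3.
    have := (bilinD (wmod_bilin W3)).2 c a x 0 j.
    by rewrite (bilin0 (wmod_bilin W3)).2 !addr0.
  rewrite deltaE !(bilinD (wmod_bilin W3)).2 YZ comm scalerDr -addrA [LHS]addrCA.
  congr (_ + _); rewrite addrCA; congr (_ + _); rewrite addrCA; congr (_ + _).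
  by rewrite scalerA -scalerDl; congr (_ *: _); rewrite !rmorphB rmorphD /=; ring.
- rewrite deltaE; congr (_ + (_ + _)); rewrite comm Dl scalerDr -[RHS]addrA [RHS]addrCA.
  congr (_ + _); rewrite scalerA -scalerDl; congr (_ *: _).
  by rewrite !rmorphB rmorphD /=; ring.
Qed.

Lemma jacobi_modes_delta Phi : bilin Phi -> (forall a, jacobi_modes Phi a) ->
  forall a, jacobi_modes (delta Phi) a.
Proof.
move=> bPhi J a u v; have bd := delta_bilin bPhi; move: u v.
apply: (direct_sum_ind (voa_direct_sum V) (P := jacobi_modes (delta Phi))).
- move=> u v; have Y0 (M : wmodule V) (w : M) k : wmod_Y (0 : V) w k = 0.
    by rewrite (bilin0 (wmod_bilin M)).1.
  apply: (@eq_jacobi_eventually _ _ (fun=> fun=> 0) (fun=> fun=> 0) (fun=> fun=> 0)).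
  + by move=> i j; rewrite Y0 (bilin0 bd).2.
  + by move=> i j; rewrite Y0.
  + by move=> i j; rewrite Y0 (bilin0 bd).1.
  + move=> l m n; exists 0%N => B _; rewrite /jacobi_sum.
    by rewrite !big1 ?subr0// => i _; rewrite scaler0.
- move=> b c Jb Jc u v; have := jacobi_eventually_lin 1 (Jb u v) (Jc u v).
  have YD (M : wmodule V) (w : M) k : wmod_Y (b + c) w k = wmod_Y b w k + wmod_Y c w k.
    by have := (bilinD (wmod_bilin M)).1 1 b c w k; rewrite !scale1r.
  apply: eq_jacobi_eventually => i j; rewrite scale1r YD.
  + by have := (bilinD bd).2 1; rewrite -[in RHS](scale1r (wmod_Y b v j)) => ->; rewrite scale1r.
  + by [].
  + by have := (bilinD bd).1 1; rewrite -[in RHS](scale1r (wmod_Y b u j)) => ->; rewrite scale1r.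
- by move=> p b pb; apply: (jacobi_modes_delta_homogeneous bPhi pb).
Qed.

End Delta.

(** * Grading, uniform truncation and local nilpotency of delta *)

Section GradedDelta.
Context {R : realType} {V : voa R} (W1 W2 W3 : wmodule V) (lam1 lam2 lam3 : R[i]).
Context (dec1 : L0_decomposed W1 lam1) (dec2 : L0_decomposed W2 lam2)
  (dec3 : L0_decomposed W3 lam3).
Implicit Types (Phi : W1 -> W2 -> int -> W3).

Local Notation lam := (lam1 + lam2 - lam3).
Local Notation d := (delta lam).

(** Target weights range over all of lam3 + Z; by [gen_eigenspace_extend0] this agrees with the
    convention that negative degrees are zero. *)
Definition graded Phi := forall (i j : nat) (n : int) u v,
  gen_eigenspace W1 (lam1 + i%:R) u -> gen_eigenspace W2 (lam2 + j%:R) v ->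
  gen_eigenspace W3 (lam3 + (i%:Z + j%:Z - n - 1)%:~R) (Phi u v n).

Lemma graded_weight (i j : nat) (n : int) :
  lam3 + (i%:Z + j%:Z - n - 1)%:~R =
  lam1 + i%:R + (lam2 + j%:R) - (n%:~R + lam + 1) :> R[i].
Proof. by rewrite !rmorphB rmorphD /= -!pmulrn; ring. Qed.

Lemma delta_shiftedL0 Phi h1 h2 u v n : bilin Phi ->
  d Phi u v n = shiftedL0 (h1 + h2 - (n%:~R + lam + 1)) (Phi u v n)
    - Phi (shiftedL0 h1 u) v n - Phi u (shiftedL0 h2 v) n.
Proof.
move=> bPhi; rewrite (shiftedL0_bilin _ _ _ _ _ _ bPhi).
by rewrite -[RHS]addrA -[X in _ = _ + X]opprD [RHS]addrC addKr.
Qed.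

Lemma delta_graded Phi : graded Phi -> graded (d Phi).
Proof.
move=> gPhi i j n u v ui vj; set h := lam3 + _.
have S := gen_eigenspace_subspace W3 h.
have [_ Sl] := S; rewrite /delta [X in gen_eigenspace _ _ X]addrC; apply: Sl; first exact: gPhi.
apply: (subspaceB S); first apply: (subspaceB S).
- by apply: gen_eigenspace_L0; apply: gPhi.
- by apply: gPhi => //; apply: gen_eigenspace_L0.
- by apply: gPhi => //; apply: gen_eigenspace_L0.
Qed.

Lemma iter_delta_bilin Phi k : bilin Phi -> bilin (iter k d Phi).
Proof. by move=> bPhi; elim: k => //= k; apply: delta_bilin. Qed.

Lemma iter_delta_graded Phi k : graded Phi -> graded (iter k d Phi).
Proof. by move=> gPhi; elim: k => //= k; apply: delta_graded. Qed.

(** For homogeneous u, v of degrees i, j the bound i + j puts the value in negative degree. It does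
    not depend on [Phi], hence serves all iterates of [delta] at once, as a truncation uniform in
    the power of log x requires. *)
Lemma graded_truncation u v : exists N : int, forall Phi, bilin Phi -> graded Phi ->
  forall n, N <= n -> Phi u v n = 0.
Proof.
have D (M : lmodType R[i]) (x y : M) : x + y = 1 *: x + y by rewrite scale1r.
apply: (direct_sum_ind2 dec1 dec2 (P := fun u v => exists N : int, forall Phi,
  bilin Phi -> graded Phi -> forall n, N <= n -> Phi u v n = 0)) => {u v}.
- by move=> v; exists 0 => Phi bPhi _ n _; rewrite (bilin0 bPhi).1.
- move=> x y v [N HN] [L HL]; exists (Num.max N L) => Phi bPhi gPhi n.
  rewrite ge_max D (bilinD bPhi).1 => /andP[nN nL].
  by rewrite HN// HL// scaler0 addr0.
- by move=> u; exists 0 => Phi bPhi _ n _; rewrite (bilin0 bPhi).2.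
- move=> u x y [N HN] [L HL]; exists (Num.max N L) => Phi bPhi gPhi n.
  rewrite ge_max D (bilinD bPhi).2 => /andP[nN nL].
  by rewrite HN// HL// scaler0 addr0.
- move=> i j u v ui vj; exists (i%:Z + j%:Z) => Phi _ gPhi n ijn.
  by apply: (gen_eigenspace_neg dec3) (gPhi i j n u v ui vj); lia.
Qed.

(** Induction on the sum of nilpotency orders of u and v. Once the iterates vanish on the pairs with
    u or v replaced by its shifted image, [delta] acts on the value as L(0) - h3, which is nilpotent
    there because the value lies in the generalized eigenspace of h3. *)
Lemma iter_delta_eventually0 Phi u v n : bilin Phi -> graded Phi ->
  exists K, forall k, (K <= k)%N -> iter k d Phi u v n = 0.
Proof.
move=> bPhi gPhi; have D (M : lmodType R[i]) (x y : M) : x + y = 1 *: x + y by rewrite scale1r.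
have bd k := iter_delta_bilin k bPhi.
apply: (direct_sum_ind2 dec1 dec2 (P := fun u v =>
  exists K, forall k, (K <= k)%N -> iter k d Phi u v n = 0)) => {u v}.
- by move=> v; exists 0%N => k _; rewrite (bilin0 (bd k)).1.
- move=> x y v [N HN] [L HL]; exists (maxn N L) => k.
  rewrite geq_max D (bilinD (bd k)).1 => /andP[kN kL].
  by rewrite HN// HL// scaler0 addr0.
- by move=> u; exists 0%N => k _; rewrite (bilin0 (bd k)).2.
- move=> u x y [N HN] [L HL]; exists (maxn N L) => k.
  rewrite geq_max D (bilinD (bd k)).2 => /andP[kN kL].
  by rewrite HN// HL// scaler0 addr0.
move=> i j u v ui vj.
move/gen_eigenspaceP: (ui) => [a ua]; move/gen_eigenspaceP: (vj) => [b vb].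
have [N abN] : exists N, (a + b <= N)%N by exists (a + b)%N.
elim: N => [|N IH] in a b u v ui vj ua vb abN *.
  have a0 : a = 0%N by lia.
  exists 0%N => k _; rewrite (_ : u = 0) ?(bilin0 (bd k)).1//.
  by rewrite a0 in ua.
case: a => [|a] in ua abN *.
  by exists 0%N => k _; rewrite (_ : u = 0) ?(bilin0 (bd k)).1.
case: b => [|b] in vb abN *.
  by exists 0%N => k _; rewrite (_ : v = 0) ?(bilin0 (bd k)).2.
pose T1 := shiftedL0 (lam1 + i%:R) u; pose T2 := shiftedL0 (lam2 + j%:R) v.
have T1i : gen_eigenspace W1 (lam1 + i%:R) T1.
  by apply/gen_eigenspaceP; exists a; apply/nilpS.
have T2j : gen_eigenspace W2 (lam2 + j%:R) T2.
  by apply/gen_eigenspaceP; exists b; apply/nilpS.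
have [K1 HK1] : exists K, forall k, (K <= k)%N -> iter k d Phi T1 v n = 0.
  by apply: (IH a b.+1) => //; apply/nilpS.
have [K2 HK2] : exists K, forall k, (K <= k)%N -> iter k d Phi u T2 n = 0.
  by apply: (IH a.+1 b) => //; [apply/nilpS|rewrite addSnnS].
pose K := maxn K1 K2; pose h3 := lam3 + (i%:Z + j%:Z - n - 1)%:~R : R[i].
have step k : (K <= k)%N -> iter k.+1 d Phi u v n = shiftedL0 h3 (iter k d Phi u v n).
  rewrite geq_max => /andP[k1 k2].
  rewrite iterS (delta_shiftedL0 (lam1 + i%:R) (lam2 + j%:R) _ _ _ (bd k)).
  by rewrite HK1// HK2// !subr0 /h3 graded_weight.
have iterK c : iter (K + c) d Phi u v n = iter c (shiftedL0 h3) (iter K d Phi u v n).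
  by elim: c => [|c IHc]; rewrite ?addn0// addnS step ?leq_addr// IHc.
have /gen_eigenspaceP[c wc] := iter_delta_graded K gPhi n ui vj.
exists (K + c)%N => k kK; rewrite -(subnKC (leq_trans (leq_addr c K) kK)) iterK.
by apply: nilp_widen wc; lia.
Qed.

End GradedDelta.

(** * Series with integral exponents *)

Section IntegralSeries.
Context {R : realType} {M : lmodType R[i]}.
Implicit Types (f : int -> M).

Lemma integral_series_int f (n : int) : integral_series f n%:~R = f n.
Proof.
rewrite /integral_series (_ : [set _ | _] = [set n]) ?fsbig_set1//.
by apply/seteqP; split=> [m /= /intr_inj|m /= ->].
Qed.

Lemma integral_series_nonint f al : (forall n : int, n%:~R <> al) -> integral_series f al = 0.
Proof. by move=> nal; apply: fsbig1 => n /nal. Qed.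

Lemma int_or_not (al : R[i]) : (exists n : int, al = n%:~R) \/ (forall n : int, n%:~R <> al).
Proof.
have [[n ->]|nal] := pselect (exists n : int, al = n%:~R); first by left; exists n.
by right=> n E; apply: nal; exists n.
Qed.

End IntegralSeries.

(** * Z-graded operators characterized by the Jacobi identity *)

Section Correspondence.
Context {R : realType} {V : voa R} (W1 W2 W3 : wmodule V) (lam1 lam2 lam3 : R[i]).
Context (dec1 : L0_decomposed W1 lam1) (dec2 : L0_decomposed W2 lam2)
  (dec3 : L0_decomposed W3 lam3).
Implicit Types (Phi : W1 -> W2 -> int -> W3) (I : W1 -> W2 -> R[i] -> nat -> W3).

Local Notation lam := (lam1 + lam2 - lam3).
Local Notation d := (delta lam).

Lemma graded_laurent Phi : bilin Phi -> graded lam1 lam2 lam3 Phi ->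
  forall u v, in_laurent (Phi u v).
Proof.
move=> bPhi gPhi u v; have [N HN] := graded_truncation dec1 dec2 dec3 u v.
by exists N => n; apply: HN.
Qed.

Lemma jacobi_modesP Phi a : bilin Phi -> graded lam1 lam2 lam3 Phi ->
  jacobi (wmod_Y a) (wmod_Y a) (wmod_Y a) Phi <-> jacobi_modes Phi a.
Proof.
move=> bPhi gPhi; apply: jacobi_eventuallyP => //.
- by move=> n; rewrite (bilin0 (wmod_bilin W3)).2.
- exact: graded_laurent.
- exact: wmod_trunc.
- exact: wmod_trunc.
Qed.

Lemma Z_intertwiningP Phi :
  @is_Z_intertwining R V (L0_graded dec1) (L0_graded dec2) (L0_graded dec3) Phi <->
  [/\ bilin Phi, graded lam1 lam2 lam3 Phi & forall a, jacobi_modes Phi a].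
Proof.
split=> [[bPhi tPhi gPhi locPhi]|[bPhi gPhi jPhi]].
  split=> // [i j n u v ui vj|a u v].
    by apply/(gen_eigenspace_extend0 dec3); apply: gPhi.
  have [G GP] := locPhi u v a.
  by apply: (eq_jacobi_eventually _ _ _ (jacobi_expand G)) => m n; have [] := GP m n.
have tPhi := graded_laurent bPhi gPhi; have [b0 b0'] := bilin0 bPhi.
split=> // [i j n u v ui vj|u v a].
  by apply/(gen_eigenspace_extend0 dec3); apply: gPhi.
apply: jacobi_localized.
- by have [N HN] := wmod_trunc a v; exists N => m n /HN ->.
- have [N HN] := tPhi u v; exists N => m n /HN ->.
  by rewrite (bilin0 (wmod_bilin W3)).2.
- by have [N HN] := wmod_trunc a u; exists N => m n /HN ->.
- exact: jPhi.
Qed.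

(** * From logarithmic to Z-graded operators *)

Section FromLog.
Context (I : W1 -> W2 -> R[i] -> nat -> W3).
Context (logI : is_log_intertwining I).

(** The modes of x^lam I^(k)(u,x)v; k = 0 gives I^o. *)
Definition log_modes (k : nat) : W1 -> W2 -> int -> W3 :=
  fun u v n => I u v (n%:~R + lam) k.

Lemma log_modes_bilin k : bilin (log_modes k).
Proof. by have [bI _ _ _ _] := logI; split=> [v n|u n]; [apply: (bI k).1|apply: (bI k).2]. Qed.

Lemma log_modes_graded k : graded lam1 lam2 lam3 (log_modes k).
Proof. by move=> i j n u v ui vj; rewrite (graded_weight lam1 lam2); apply: log_gen_eigenspace. Qed.

Lemma log_modes_jacobi k a : jacobi_modes (log_modes k) a.
Proof.
apply/jacobi_modesP; [exact: log_modes_bilin|exact: log_modes_graded|].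
have [_ _ _ jI _] := logI; move=> u v l m n; have := jI a k u v l m (n%:~R + lam).
have eqD (c : int) : (n + c)%:~R + lam = n%:~R + lam + c%:~R by rewrite rmorphD addrAC.
rewrite /log_modes.
under [X in X - _ = _ -> _]eq_fsbigr do rewrite pmulrn -eqD.
under [X in _ - X = _ -> _]eq_fsbigr do rewrite pmulrn -addrA -rmorphB -eqD.
under [X in _ = X -> _]eq_fsbigr do rewrite pmulrn -addrA -rmorphB -eqD.
under [X in _ -> X - _ = _]eq_fsbigr do rewrite natz.
under [X in _ -> _ - X = _]eq_fsbigr do rewrite natz intz -addrA.
by under [X in _ -> _ = X]eq_fsbigr do rewrite natz intz -addrA.
Qed.

Lemma log_modes_succ k u v n : k.+1%:R *: log_modes k.+1 u v n = d (log_modes k) u v n.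
Proof. by rewrite /log_modes (log_succ logI). Qed.

(** Iterating the recursion expresses every logarithmic coefficient through I^o, which gives
    injectivity. *)
Lemma log_modes_iter k u v n : k`!%:R *: log_modes k u v n = iter k d (log_modes 0) u v n.
Proof.
elim: k u v n => [|k IH] u v n; first by rewrite scale1r.
rewrite iterS factS mulnC natrM -scalerA log_modes_succ /delta -!IH.
by rewrite wmod_LZ [_ *: (k`!%:R *: _)]scalerA [_ * k`!%:R]mulrC -scalerA -!scalerBr -scalerDr.
Qed.

(** On homogeneous vectors the coefficient is a generalized eigenvector whose eigenvalue lies
    outside lam3 + Z, hence zero. *)
Lemma log_nonint u v al k : (forall n : int, n%:~R <> al - lam) -> I u v al k = 0.
Proof.
have [bI _ _ _ _] := logI; move=> nal; have [b0 b0'] := bilin0 (bI k).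
have D (M : lmodType R[i]) (x y : M) : x + y = 1 *: x + y by rewrite scale1r.
apply: (direct_sum_ind2 dec1 dec2 (P := fun u v => I u v al k = 0)) => {u v}.
- by move=> v; rewrite b0.
- by move=> x y v x0 y0; rewrite D (bilinD (bI k)).1 x0 y0 scaler0 addr0.
- by move=> u; rewrite b0'.
- by move=> u x y x0 y0; rewrite D (bilinD (bI k)).2 x0 y0 scaler0 addr0.
move=> i j u v ui vj; apply: (gen_eigenspace_nonint dec3) (log_gen_eigenspace logI al k ui vj).
move=> n E; apply: (nal (i%:Z + j%:Z - n - 1)).
rewrite !rmorphB rmorphD /= -!pmulrn.
have -> : n%:~R = lam1 + i%:R + (lam2 + j%:R) - (al + 1) - lam3 by rewrite E addrC addKr.
by ring.
Qed.

End FromLog.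

(** * From Z-graded to logarithmic operators *)

Section ToLog.
Context (Phi : W1 -> W2 -> int -> W3).
Context (bPhi : bilin Phi) (gPhi : graded lam1 lam2 lam3 Phi)
  (jPhi : forall a, jacobi_modes Phi a).

Let mode k u v n : W3 := (k`!%:R)^-1 *: iter k d Phi u v n.

(* exp(log x delta) Phi, with exponents shifted to lam + Z. *)
Definition exp_log : W1 -> W2 -> R[i] -> nat -> W3 :=
  fun u v al k => integral_series (mode k u v) (al - lam).

Lemma exp_log_int u v al k (n : int) : al = n%:~R + lam ->
  exp_log u v al k = mode k u v n.
Proof. by move=> ->; rewrite /exp_log addrK integral_series_int. Qed.

Lemma exp_log_nonint u v al k : (forall n : int, n%:~R <> al - lam) ->
  exp_log u v al k = 0.
Proof. exact: integral_series_nonint. Qed.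

Lemma lattice_or_not (al : R[i]) :
  (exists n : int, al = n%:~R + lam) \/ (forall n : int, n%:~R <> al - lam).
Proof.
have [[n E]|] := int_or_not (al - lam); last by right.
by left; exists n; rewrite -E subrK.
Qed.

Lemma nonint_shift (al : R[i]) (m : int) :
  (forall n : int, n%:~R <> al - lam) -> forall n : int, n%:~R <> al + m%:~R - lam.
Proof.
move=> nal n E; apply: (nal (n - m)); rewrite rmorphB /= E addrAC.
by rewrite addrK.
Qed.

Lemma mode_bilin k : bilin (mode k).
Proof. by apply: (bilin_scale (fun=> _)); apply: iter_delta_bilin. Qed.

Lemma mode_graded k : graded lam1 lam2 lam3 (mode k).
Proof.
move=> i j n u v ui vj; apply: subspaceZ; first exact: gen_eigenspace_subspace.
exact: (iter_delta_graded k gPhi).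
Qed.

Lemma mode_jacobi k a : jacobi_modes (mode k) a.
Proof.
have jk : forall a, jacobi_modes (iter k d Phi) a.
  elim: k => //= k IH; apply: jacobi_modes_delta => //; exact: iter_delta_bilin.
move=> u v; pose c : R[i] := (k`!%:R)^-1.
(* The inner combination is the zero triple, so the outer one is multiplication by c. *)
have := jacobi_eventually_lin c (jk a u v) (jacobi_eventually_lin (-1) (jk a u v) (jk a u v)).
have E x : c *: x + (- 1 *: x + x) = c *: x :> W3 by rewrite scaleN1r addNr addr0.
apply: eq_jacobi_eventually => i j; rewrite /mode E //.
have := (bilinD (wmod_bilin W3)).2 c a (iter k d Phi u v i) 0 j.
by rewrite (bilin0 (wmod_bilin W3)).2 !addr0.
Qed.

Lemma mode_succ k u v n : k.+1%:R *: mode k.+1 u v n = d (mode k) u v n.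
Proof.
rewrite /mode /delta wmod_LZ iterS factS natrM invfM !scalerA mulrA divff ?pnatr_eq0//.
by rewrite mul1r [_ * k`!%:R^-1]mulrC -!scalerA -!scalerBr -scalerDr.
Qed.

(** Finiteness in log x is local nilpotency of [delta], and truncation is the bound uniform in the
    iterates. The Jacobi identity holds separately on each coset of Z, and off lam + Z every term is
    zero. *)
Lemma exp_log_intertwining : is_log_intertwining exp_log.
Proof.
split.
- move=> k; have [Dl Dr] := bilinD (mode_bilin k).
  split=> [v al|u al] c x y /=; have [[n E]|E] := lattice_or_not al.
  + by rewrite !(exp_log_int _ _ _ E) Dl.
  + by rewrite !exp_log_nonint// scaler0 addr0.
  + by rewrite !(exp_log_int _ _ _ E) Dr.
  + by rewrite !exp_log_nonint// scaler0 addr0.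
- move=> u v al; have [[n E]|E] := lattice_or_not al.
    have [K HK] := iter_delta_eventually0 dec1 dec2 u v n bPhi gPhi.
    by exists K => k /HK k0; rewrite (exp_log_int _ _ _ E) /mode k0 scaler0.
  by exists 0%N => k _; rewrite exp_log_nonint.
- move=> u v al; have [[n E]|E] := lattice_or_not al.
    have [N HN] := graded_truncation dec1 dec2 dec3 u v.
    exists `|N - n|%N => m k Nm.
    rewrite (@exp_log_int _ _ _ _ (n + m%:Z)); last first.
      by rewrite E rmorphD addrAC pmulrn.
    by apply: HN; [apply: mode_bilin|apply: mode_graded|lia].
  by exists 0%N => m k _; rewrite exp_log_nonint// pmulrn; apply: nonint_shift.
- move=> a k u v l m al; have [[n ->]|E] := lattice_or_not al.
    have /(jacobi_modesP a (mode_bilin k) (mode_graded k)) jk := @mode_jacobi k a.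
    have expD u' v' (i : nat) : exp_log u' v' (n%:~R + lam + i%:R) k = mode k u' v' (n + i%:R).
      by apply: exp_log_int; rewrite natz rmorphD addrAC pmulrn.
    have expB u' v' (c : int) (i : nat) :
        exp_log u' v' (n%:~R + lam + c%:~R - i%:R) k = mode k u' v' (n + c%:~R - i%:R).
      apply: exp_log_int; rewrite natz intz rmorphB rmorphD /= pmulrn.
      by rewrite [in RHS]addrAC; congr (_ - _); rewrite addrAC.
    under [X in X - _ = _]eq_fsbigr do rewrite expD.
    under [X in _ - X = _]eq_fsbigr do rewrite expB.
    under [X in _ = X]eq_fsbigr do rewrite expB.
    exact: jk.
  have nal u' v' (c : int) : exp_log u' v' (al + c%:~R) k = 0.
    by apply: exp_log_nonint; apply: nonint_shift.
  rewrite [X in X - _]fsum0 => [|i]; last first.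
    by rewrite pmulrn nal (bilin0 (wmod_bilin W3)).2 scaler0.
  rewrite [X in _ - X]fsum0 => [|i]; last by rewrite pmulrn -addrA -rmorphB nal scaler0.
  by rewrite fsum0 ?subr0// => i; rewrite pmulrn -addrA -rmorphB nal scaler0.
move=> u v; apply/funext => al; apply/funext => k; rewrite /log_derivative.
have [[n E]|E] := lattice_or_not al; last first.
  have := @nonint_shift _ (-1) E; rewrite mulrN1z => E1.
  rewrite exp_log_nonint// !(@exp_log_nonint _ _ (al - 1))//.
  by rewrite !scaler0 addr0.
have E1 : al - 1 = (n - 1)%:~R + lam by rewrite E rmorphB /= addrAC.
(* By [mode_succ] the logarithmic term of the derivative is [delta] of the k-th mode at n - 1. The
   L(0) commutator evaluates it to the mode of L(-1)u at n plus al times the k-th mode at n - 1, and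
   the latter cancels the other term of the derivative. *)
rewrite (exp_log_int _ _ _ E) !(exp_log_int _ _ _ E1) mode_succ.
have /(jacobi_modesP _ (mode_bilin k) (mode_graded k)) jo := @mode_jacobi k (omega V).
have := jacobi_L0 u v (n - 1) (bilin0 (mode_bilin k)).2 jo.
rewrite subrK /delta => ->; rewrite -E1 subrK addrK [RHS]addrC -addrA scaleNr.
by rewrite subrr addr0.
Qed.

End ToLog.

(** * The two mutually inverse maps *)

Lemma log_modes_Z (I : I_log W1 W2 W3) :
  log_modes I 0 \in @Z_intertwining_pred R V (L0_graded dec1) (L0_graded dec2) (L0_graded dec3).
Proof.
have logI : is_log_intertwining I by apply/asboolP; apply: I_log_prop.
apply/asboolP/Z_intertwiningP; split.
- exact: log_modes_bilin.
- exact: log_modes_graded.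
- by move=> a; apply: log_modes_jacobi.
Qed.

Definition log_to_Z (I : I_log W1 W2 W3) :
  I_Z (L0_graded dec1) (L0_graded dec2) (L0_graded dec3) := IZ (log_modes_Z I).

Lemma log_to_Z_linear : linear log_to_Z.
Proof. by move=> c I J; apply: val_inj. Qed.

Lemma log_to_Z_series (I : I_log W1 W2 W3) u v :
  integral_series (log_to_Z I u v) = mul_xpow lam (fun al => I u v al 0%N).
Proof.
have logI : is_log_intertwining I by apply/asboolP; apply: I_log_prop.
apply/funext => al; rewrite /mul_xpow; have [[n ->]|nal] := int_or_not al.
  by rewrite integral_series_int.
rewrite integral_series_nonint// (log_nonint logI)// => n; rewrite addrK; exact: nal.
Qed.

Lemma exp_log_mem (Phi : I_Z (L0_graded dec1) (L0_graded dec2) (L0_graded dec3)) :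
  exp_log Phi \in @log_intertwining_pred R V W1 W2 W3.
Proof.
have /asboolP/Z_intertwiningP[bPhi gPhi jPhi] := I_Z_prop Phi.
by apply/asboolP; apply: exp_log_intertwining.
Qed.

Definition Z_to_log (Phi : I_Z (L0_graded dec1) (L0_graded dec2) (L0_graded dec3)) :
  I_log W1 W2 W3 := ILog (exp_log_mem Phi).

(** On lam + Z both sides equal delta^k I^o / k!; elsewhere both vanish. *)
Lemma log_to_ZK : cancel log_to_Z Z_to_log.
Proof.
move=> I; have logI : is_log_intertwining I by apply/asboolP; apply: I_log_prop.
apply: val_inj; apply/funext => u; apply/funext => v; apply/funext => al; apply/funext => k /=.
have [[n E]|nal] := lattice_or_not al; last by rewrite exp_log_nonint// (log_nonint logI).
rewrite (exp_log_int _ _ _ _ E) -(log_modes_iter logI) scalerA mulVf ?scale1r /log_modes ?E//.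
by rewrite pnatr_eq0 -lt0n fact_gt0.
Qed.

Lemma Z_to_logK : cancel Z_to_log log_to_Z.
Proof.
move=> Phi; apply: val_inj; do 3![apply/funext => ?] => /=.
by rewrite /log_modes (exp_log_int _ _ _ _ erefl) invr1 scale1r.
Qed.

End Correspondence.

Theorem proposition4p3 (R : realType) (V : voa R) (W1 W2 W3 : wmodule V)
    (lam1 lam2 lam3 : R[i])
    (dec1 : L0_decomposed W1 lam1) (dec2 : L0_decomposed W2 lam2)
    (dec3 : L0_decomposed W3 lam3)
    (fin1 : forall n : int, finite_dim (gen_eigenspace W1 (lam1 + n%:~R)))
    (fin2 : forall n : int, finite_dim (gen_eigenspace W2 (lam2 + n%:~R)))
    (fin3 : forall n : int, finite_dim (gen_eigenspace W3 (lam3 + n%:~R))) :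
  exists F : {linear I_log W1 W2 W3 ->
               I_Z (L0_graded dec1) (L0_graded dec2) (L0_graded dec3)},
    (forall (I : I_log W1 W2 W3) (u : W1) (v : W2),
       integral_series (F I u v) =
       mul_xpow (lam1 + lam2 - lam3) (fun al => I u v al 0%N)) /\
    bijective F.
Proof.
pose F : {linear I_log W1 W2 W3 -> I_Z (L0_graded dec1) (L0_graded dec2) (L0_graded dec3)} :=
  HB.pack (log_to_Z dec1 dec2 dec3)
    (GRing.isLinear.Build _ _ _ _ _ (log_to_Z_linear dec1 dec2 dec3)).
exists F; split; first exact: log_to_Z_series.
by exists (@Z_to_log _ _ _ _ _ _ _ _ dec1 dec2 dec3); [apply: log_to_ZK|apply: Z_to_logK].
Qed.
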